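(* Let $\sigma\in[0,1]$ and consider the equation $$\sum_{i,j=1}^n\Big(\delta_{ij}-\frac{u_iu_j}{\sigma+|Du|^2}\Big)u_{ij}=1. \qquad ( * )$$ (a) For every $n\ge2$ and $1\le k\le n$ there exist complete convex solutions of $( * )$, defined in strip regions of $\mathbb{R}^n$, which are not $k$-rotationally symmetric. (b) If $n\ge3$ and $1\le k\le n$, there exist entire convex solutions of $( * )$ (defined on all of $\mathbb{R}^n$) which are not $k$-rotationally symmetric.
   Context: Subscripts denote partial derivatives. A convex solution $u$ is complete if its graph is a complete hypersurface in $\mathbb{R}^{n+1}$, and entire if it is defined on all of $\mathbb{R}^n$. A strip region is the open region between two parallel hyperplanes of $\mathbb{R}^n$. A function $u$ is $k$-rotationally symmetric ($1\le k\le n$) if in an appropriate (Euclidean) coordinate system $u$ is rotationally symmetric with respect to $x_1,\dots,x_k$ and independent of $x_{k+1},\dots,x_n$, i.e. $u(x)=\varphi\big((x_1^2+\dots+x_k^2)^{1/2}\big)$. For $\sigma>0$ solutions are classical. For $\sigma=0$ solutions are understood in the viscosity sense: $u$ is a subsolution (supersolution) if, whenever $\varphi\in C^2$ and $u-\varphi$ has a local maximum (minimum) at $x_0$, then $\sum(\delta_{ij}-\varphi_i\varphi_j/|D\varphi|^2)\varphi_{ij}\ge 1$ ($\le 1$) at $x_0$ if $D\varphi(x_0)\ne0$, and $\sum(\delta_{ij}-\eta_i\eta_j)\varphi_{ij}(x_0)\ge 1$ ($\le 1$) for some $\eta$ with $|\eta|\le1$ if $D\varphi(x_0)=0$; a solution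 is both. *)

(* Defs.v *)
From HB Require Import structures.
From mathcomp Require Import all_boot all_order all_algebra.
From mathcomp Require Import all_classical all_reals all_analysis.

Set Implicit Arguments.
Unset Strict Implicit.
Unset Printing Implicit Defensive.

Import Order.TTheory GRing.Theory Num.Theory.
Import numFieldNormedType.Exports.

Local Open Scope classical_set_scope.
Local Open Scope ring_scope.

(* The library norm on ['rV[R]_n] is the sup norm: it serves for the topology
   and for derivatives only, and all lengths are measured with [enorm]. *)
Definition dot (R : realType) (n : nat) (x y : 'rV[R]_n) : R :=
  \sum_(i < n) x 0 i * y 0 i.

Definition enorm (R : realType) (n : nat) (x : 'rV[R]_n) : R :=
  Num.sqrt (dot x x).

Definition partial (R : realType) (n : nat) (i : 'I_n)
    (u : 'rV[R]_n -> R) : 'rV[R]_n -> R :=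
  fun x => 'D_(delta_mx 0 i) u x.

Definition grad (R : realType) (n : nat) (u : 'rV[R]_n -> R)
    (x : 'rV[R]_n) : 'rV[R]_n :=
  \row_(i < n) partial i u x.

Definition hess (R : realType) (n : nat) (u : 'rV[R]_n -> R)
    (x : 'rV[R]_n) : 'M[R]_n :=
  \matrix_(i < n, j < n) partial j (partial i u) x.

(* Functions on an open set [Om] are total functions, of which only the values
   on [Om] matter. *)
Definition C2_on (R : realType) (n : nat) (Om : set 'rV[R]_n)
    (u : 'rV[R]_n -> R) : Prop :=
  forall x, Om x ->
    [/\ {for x, continuous u},
        forall i, derivable u x (delta_mx 0 i) /\
                  {for x, continuous (partial i u)}
      & forall i j, derivable (partial i u) x (delta_mx 0 j) /\
                    {for x, continuous (partial j (partial i u))}].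

(* [(delta_ij - p_i p_j / c) H_ij] summed over [i, j] *)
Definition mc_op (R : realType) (n : nat) (c : R) (p : 'rV[R]_n)
    (H : 'M[R]_n) : R :=
  \sum_(i < n) \sum_(j < n) ((i == j)%:R - p 0 i * p 0 j / c) * H i j.

Definition classical_solution (R : realType) (n : nat) (sigma : R)
    (Om : set 'rV[R]_n) (u : 'rV[R]_n -> R) : Prop :=
  C2_on Om u /\
  forall x, Om x ->
    mc_op (sigma + enorm (grad u x) ^+ 2) (grad u x) (hess u x) = 1.

Definition viscosity_subsolution (R : realType) (n : nat)
    (Om : set 'rV[R]_n) (u : 'rV[R]_n -> R) : Prop :=
  forall (phi : 'rV[R]_n -> R) (x0 : 'rV[R]_n),
    C2_on Om phi -> Om x0 ->
    (\forall y \near x0, u y - phi y <= u x0 - phi x0) ->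
    (grad phi x0 != 0 ->
       1 <= mc_op (enorm (grad phi x0) ^+ 2) (grad phi x0) (hess phi x0)) /\
    (grad phi x0 = 0 ->
       exists2 eta : 'rV[R]_n, enorm eta <= 1 & 1 <= mc_op 1 eta (hess phi x0)).

Definition viscosity_supersolution (R : realType) (n : nat)
    (Om : set 'rV[R]_n) (u : 'rV[R]_n -> R) : Prop :=
  forall (phi : 'rV[R]_n -> R) (x0 : 'rV[R]_n),
    C2_on Om phi -> Om x0 ->
    (\forall y \near x0, u x0 - phi x0 <= u y - phi y) ->
    (grad phi x0 != 0 ->
       mc_op (enorm (grad phi x0) ^+ 2) (grad phi x0) (hess phi x0) <= 1) /\
    (grad phi x0 = 0 ->
       exists2 eta : 'rV[R]_n, enorm eta <= 1 & mc_op 1 eta (hess phi x0) <= 1).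

Definition viscosity_solution (R : realType) (n : nat)
    (Om : set 'rV[R]_n) (u : 'rV[R]_n -> R) : Prop :=
  viscosity_subsolution Om u /\ viscosity_supersolution Om u.

Definition solution (R : realType) (n : nat) (sigma : R)
    (Om : set 'rV[R]_n) (u : 'rV[R]_n -> R) : Prop :=
  (0 < sigma -> classical_solution sigma Om u) /\
  (sigma = 0 -> viscosity_solution Om u).

Definition convex_solution (R : realType) (n : nat) (sigma : R)
    (Om : set 'rV[R]_n) (u : 'rV[R]_n -> R) : Prop :=
  convex_function Om u /\ solution sigma Om u.

Definition graph (R : realType) (n : nat) (Om : set 'rV[R]_n)
    (u : 'rV[R]_n -> R) : set 'rV[R]_(n + 1) :=
  [set row_mx x (u x)%:M | x in Om].

Definition polygonal_length (R : realType) (m : nat) (gamma : R -> 'rV[R]_m)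
    (s : seq R) : R :=
  let F := gamma \o nth 1 (0 :: s) in
  \sum_(0 <= i < size s) enorm (F i.+1 - F i).

Definition curve_length (R : realType) (m : nat) (gamma : R -> 'rV[R]_m)
    : \bar R :=
  ereal_sup [set (polygonal_length gamma s)%:E | s in itv_partition 0 1].

(* Induced length distance; it is [+oo] between points of [S] which no
   rectifiable curve in [S] joins. For a smooth hypersurface it is the
   Riemannian distance of the induced metric, and it makes sense for the
   nonsmooth graphs that occur when [sigma = 0]. *)
Definition intrinsic_dist (R : realType) (m : nat) (S : set 'rV[R]_m)
    (p q : 'rV[R]_m) : \bar R :=
  ereal_inf [set curve_length gamma | gamma in
    [set gamma : R -> 'rV[R]_m |
      [/\ {within `[0, 1], continuous gamma},
          (forall t, t \in `[0, 1] -> S (gamma t)),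
          gamma 0 = p & gamma 1 = q]]].

Definition complete_hypersurface (R : realType) (m : nat)
    (S : set 'rV[R]_m) : Prop :=
  forall p : nat -> 'rV[R]_m,
    (forall i, S (p i)) ->
    (forall e : R, 0 < e -> exists N : nat, forall i j : nat,
       (N <= i)%N -> (N <= j)%N -> (intrinsic_dist S (p i) (p j) < e%:E)%E) ->
    exists2 q, S q & intrinsic_dist S (p i) q @[i --> \oo] --> (0 : \bar R).

Definition complete_convex_solution (R : realType) (n : nat) (sigma : R)
    (Om : set 'rV[R]_n) (u : 'rV[R]_n -> R) : Prop :=
  convex_solution sigma Om u /\ complete_hypersurface (graph Om u).

Definition entire_convex_solution (R : realType) (n : nat) (sigma : R)
    (u : 'rV[R]_n -> R) : Prop :=
  convex_solution sigma [set: 'rV[R]_n] u.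

Definition strip_region (R : realType) (n : nat) (Om : set 'rV[R]_n) : Prop :=
  exists (nu : 'rV[R]_n) (a b : R),
    [/\ nu != 0, a < b & Om = [set x | a < dot nu x < b]].

(* [x *m Q + c] are the coordinates of [x] in a Euclidean coordinate system;
   the first [k] of them are those of index [i < k]. *)
Definition k_rotationally_symmetric (R : realType) (n k : nat)
    (Om : set 'rV[R]_n) (u : 'rV[R]_n -> R) : Prop :=
  exists (Q : 'M[R]_n) (c : 'rV[R]_n) (phi : R -> R),
    Q *m Q^T = 1%:M /\
    forall x, Om x ->
      u x = phi (Num.sqrt (\sum_(i < n | (i < k)%N) (x *m Q + c) 0 i ^+ 2)).

(* Main.v *)
(* If [v] solves the equation with constant [sigma + 1] and does not depend on
   the variable [z], then [v + z] solves it with constant [sigma]. On a line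
   parallel to the [z]-axis this tilted solution is injective, while a function
   of the distance to an affine subspace takes equal values at mirror points of
   any line on which it is not constant; so it is [k]-rotationally symmetric for
   no [k]. Part (a) tilts the grim reaper [- c ln (cos (x / sqrt c))] and part (b)
   the bowl soliton over the plane, with [c = sigma + 1]. The gradient never
   vanishes, so for [sigma = 0] the viscosity inequalities are second order
   conditions at touching points.

   The bowl is [c G ((x^2 + y^2) / c)], where [p = G'] solves
   [4 s p' = (1 - 2 p) (1 + 4 s p^2) - 2 p], which is singular at [s = 0]. In the
   form [s e^(s/2) p = int_0^s e^(t/2) (1/4 + t (p^2 - 2 p^3 + p/2)) dt] the right
   side is monotone in [p] between the barriers [0] and [1/2], so the iterates
   starting from [0] increase to a global solution. *)
Require Import Defs.
From HB Require Import structures.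
From mathcomp Require Import all_boot all_order all_algebra.
From mathcomp Require Import all_classical all_reals all_analysis.
From mathcomp Require Import measurable_realfun ring lra.
Set Implicit Arguments.
Unset Strict Implicit.
Unset Printing Implicit Defensive.
Import Order.TTheory GRing.Theory Num.Theory.
Import numFieldNormedType.Exports.
Local Open Scope classical_set_scope.
Local Open Scope ring_scope.

(** * The slope of the bowl *)

Lemma is_derive1_mulr (R : realType) (k x : R) :
  is_derive x 1 (fun t : R => t * k) k.
Proof.
rewrite (_ : (fun t : R => t * k) = k *: id).
  by apply: is_derive_eq; rewrite /GRing.scale /= mulr1.
by apply/funext => t; rewrite mulrC.
Qed.

(* The slope equation [4 s p' = (1 - 2 p) (1 + 4 s p^2) - 2 p] reads
   [(s p)' = 1/4 + s (p^2 - 2 p^3)]. Adding [p / 2] makes the nonlinearity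
   nondecreasing on [[0, 1/2]]; the weight [e^(s/2)] below compensates for it. *)
Definition slope_rhs (R : realType) (y : R) : R := y ^+ 2 - 2 * y ^+ 3 + y / 2.

(** The difference quotient is twice a sum of three terms, each nonnegative on [0, 1/2]. The
    coefficient 1/2 of the added linear term is the least possible: the derivative of y^2 - 2 y^3
    falls to -1/2 at y = 1/2. *)
Lemma slope_rhs_homo (R : realType) (x y : R) :
  0 <= x -> x <= y -> y <= 1 / 2 -> slope_rhs x <= slope_rhs y.
Proof.
move=> x0 xy y2; rewrite -subr_ge0 /slope_rhs.
have -> : y ^+ 2 - 2 * y ^+ 3 + y / 2 - (x ^+ 2 - 2 * x ^+ 3 + x / 2) =
  (y - x) * (y * (1 / 2 - y) *+ 2 + x * (1 / 2 - y) *+ 2 + (1 / 4 - x ^+ 2) *+ 2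
   ) by field.
by apply: mulr_ge0; nra.
Qed.

Lemma slope_rhs_continuous (R : realType) : continuous (@slope_rhs R).
Proof.
move=> x; apply: cvgD; last by apply: cvgM => //; exact: cvg_cst.
apply: cvgB; first exact: exprn_continuous.
by apply: cvgM; [exact: cvg_cst|exact: exprn_continuous].
Qed.

Lemma slope_rhs_itv (R : realType) (x : R) : 0 <= x <= 1 / 2 -> 0 <= slope_rhs x <= 1 / 4.
Proof.
move=> /andP[x0 x2]; apply/andP; split.
  apply: le_trans (slope_rhs_homo (lexx 0) x0 x2).
  by rewrite /slope_rhs; lra.
by apply: le_trans (slope_rhs_homo x0 x2 (lexx _)) _; rewrite /slope_rhs; lra.
Qed.

(** For a solution [p] of the slope equation this is the derivative of s e^(s/2) p(s). *)
Definition integrand (R : realType) (p : R -> R) (t : R) : R :=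
  expR (t / 2) * (1 / 4 + t * slope_rhs (p t)).

Definition primitive (R : realType) (p : R -> R) (s : R) : R :=
  \int[lebesgue_measure]_(t in `[0, s]) integrand p t.

(* Equal to [0] for [s <= 0], where the domain of integration is negligible. *)
Definition picard (R : realType) (p : R -> R) (s : R) : R :=
  expR (- (s / 2)) * s^-1 * primitive p s.

(** Measurability, unlike continuity, passes to pointwise limits of the iterates; continuity is
    recovered afterwards from the fixed point equation. *)
Definition admissible (R : realType) (p : R -> R) : Prop :=
  measurable_fun [set: R] p /\ forall s, 0 <= p s <= 1 / 2.

Lemma integrand_ge0 (R : realType) (p : R -> R) (t : R) :
  admissible p -> 0 <= t -> 0 <= integrand p t.
Proof.
move=> [_ pb] t0; apply: mulr_ge0; first exact: expR_ge0.
have /andP[g0 _] := slope_rhs_itv (pb t); nra.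
Qed.

Lemma integrand_le (R : realType) (p : R -> R) (t : R) :
  admissible p -> 0 <= t -> integrand p t <= expR (t / 2) * ((1 + t) / 4).
Proof.
move=> [_ pb] t0; apply: ler_wpM2l; first exact: expR_ge0.
have /andP[_ g0] := slope_rhs_itv (pb t); nra.
Qed.

Lemma measurable_integrand (R : realType) (p : R -> R) :
  admissible p -> measurable_fun [set: R] (integrand p).
Proof.
move=> [mp _]; apply: measurable_funM.
  apply: measurableT_comp; first exact: measurable_expR.
  exact: measurable_funM.
apply: measurable_funD; first exact: measurable_cst.
apply: measurable_funM => //.
apply: measurable_funD; last by apply: measurable_funM.
apply: measurable_funB; first exact: measurable_funX.
by apply: measurable_funM; [exact: measurable_cst|exact: measurable_funX].
Qed.

Lemma integrable_integrand (R : realType) (p : R -> R) (s : R) :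
  admissible p ->
  lebesgue_measure.-integrable `[0, s] (EFin \o integrand p).
Proof.
move=> ap; apply: measurable_bounded_integrable => //.
- by rewrite /= lebesgue_measure_itv/=; case: ifP => _; rewrite ?ltry.
- by apply: measurable_funTS; exact: measurable_integrand.
exists (expR (s / 2) * ((1 + s) / 4)); split; first exact: num_real.
move=> M ltM x; rewrite /= in_itv/= => /andP[x0 xs].
rewrite ger0_norm ?integrand_ge0//; apply: le_trans (integrand_le ap x0) _.
apply: le_trans (ltW ltM).
by apply: ler_pM; rewrite ?expR_ge0 ?ler_expR//; lra.
Qed.

(** The integrand is nonnegative on the half line. This monotonicity yields both the measurability
    of [picard p] and its lower barrier. *)
Lemma primitive_homo (R : realType) (p : R -> R) :
  admissible p -> {homo primitive p : x y / x <= y}.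
Proof.
move=> ap x y xy.
have [x0|x0] := ltP x 0.
  rewrite /primitive [`[0, x]%classic]set_itv_ge ?bnd_simp -?ltNge//.
  rewrite Rintegral_set0; apply: Rintegral_ge0 => t /=; rewrite in_itv/= => /andP[t0 _].
  exact: integrand_ge0.
rewrite -subr_ge0 /primitive Rintegral_itvB ?bnd_simp//.
  apply: Rintegral_ge0 => t /=; rewrite in_itv/= => /andP[t0 _].
  by apply: integrand_ge0 => //; lra.
exact: integrable_integrand.
Qed.

Lemma primitive_le0 (R : realType) (p : R -> R) (s : R) :
  s <= 0 -> primitive p s = 0.
Proof.
rewrite /primitive le_eqVlt => /predU1P[->|s0]; first by rewrite set_itv1 Rintegral_set1.
by rewrite set_itv_ge ?Rintegral_set0// bnd_simp -ltNge.
Qed.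

(** Upper barrier: the right side is s e^(s/2) times 1/2, and its derivative e^(s/2) (1/2 + s/4)
    dominates the bound e^(s/2) (1 + s)/4 on the integrand. *)
Lemma primitive_ub (R : realType) (p : R -> R) (s : R) :
  admissible p -> 0 < s -> primitive p s <= s * expR (s / 2) / 2.
Proof.
move=> ap s0.
pose f (t : R) := expR (t / 2) * (1 / 2 + t / 4).
pose F (t : R) := t * expR (t / 2) / 2.
have dF (x : R) : is_derive x 1 F (f x).
  have d1 : is_derive x 1 (fun t : R => expR (t / 2)) (expR (x / 2) * (2^-1)).
    apply: (@is_derive1_comp _ expR (fun t : R => t / 2)).
    exact: is_derive1_mulr.
  apply: is_derive_eq; rewrite /f /GRing.scale /=; by field.
have cf : continuous f.
  move=> x; apply: cvgM.
    by apply: continuous_comp; [apply: cvgM => //; exact: cvg_cst|exact: continuous_expR].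
  by apply: cvgD; [exact: cvg_cst|apply: cvgM => //; exact: cvg_cst].
have cF : continuous F.
  by move=> x; apply/differentiable_continuous/derivable1_diffP; case: (dF x).
have intf : lebesgue_measure.-integrable `[0, s] (EFin \o f).
  apply: continuous_compact_integrable; first exact: segment_compact.
  exact: continuous_subspaceT.
have <- : \int[lebesgue_measure]_(t in `[0, s]) f t = s * expR (s / 2) / 2.
  rewrite /Rintegral (@continuous_FTC2 _ f F)//=.
  - by rewrite /F mul0r mul0r subr0.
  - exact: continuous_subspaceT.
  - split; first by move=> x _; case: (dF x).
    + exact/cvg_at_right_filter/cF.
    + exact/cvg_at_left_filter/cF.
  - by move=> x _; rewrite derive1E; case: (dF x).
apply: le_Rintegral => //; first exact: integrable_integrand.
move=> t /=; rewrite in_itv/= => /andP[t0 _].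
apply: le_trans (integrand_le ap t0) _.
by apply: ler_wpM2l; [exact: expR_ge0|lra].
Qed.

Lemma picard_admissible (R : realType) (p : R -> R) :
  admissible p -> admissible (picard p).
Proof.
move=> ap; split.
  (* [^-1] has no measurability lemma on the whole line, [powR] has one. *)
  rewrite (_ : picard p = fun s => expR (- (s / 2)) * s `^ (-1) * primitive p s).
    apply: measurable_funM.
      apply: measurable_funM; last exact: measurable_powR.
      apply: measurableT_comp; first exact: measurable_expR.
      apply: measurableT_comp; first exact: oppr_measurable.
      exact: measurable_funM.
    by apply: nondecreasing_measurable => //; exact: primitive_homo.
  apply/funext => s; rewrite /picard; have [s0|s0] := leP s 0.
    by rewrite primitive_le0// !mulr0.
  by rewrite powR_inv1// ltW.
move=> s; have [s0|s0] := leP s 0; first by rewrite /picard primitive_le0// mulr0; lra.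
rewrite /picard; apply/andP; split.
  apply: mulr_ge0; first by rewrite mulr_ge0 ?expR_ge0// invr_ge0 ltW.
  by rewrite -(primitive_le0 p (lexx 0)); apply: primitive_homo => //; exact: ltW.
have := primitive_ub ap s0; set I := primitive p s.
have e0 := expR_gt0 (s / 2); rewrite expRN => H.
rewrite -invfM mulrC ler_pdivrMr ?mulr_gt0//; lra.
Qed.

Lemma picard_homo (R : realType) (p q : R -> R) :
  admissible p -> admissible q -> (forall s, p s <= q s) ->
  forall s, picard p s <= picard q s.
Proof.
move=> ap aq pq s; have [s0|s0] := leP s 0.
  by rewrite /picard !primitive_le0// mulr0.
apply: ler_wpM2l; first by rewrite mulr_ge0 ?expR_ge0// invr_ge0 ltW.
apply: le_Rintegral => //; [exact: integrable_integrand|exact: integrable_integrand|].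
move=> t /=; rewrite in_itv/= => /andP[t0 _].
apply: ler_wpM2l; first exact: expR_ge0.
rewrite lerD2l; apply: ler_wpM2l => //.
have [_ pb] := ap; have [_ qb] := aq.
by apply: slope_rhs_homo => //; [case/andP: (pb t)|case/andP: (qb t)].
Qed.

(** * Monotone iteration from the lower barrier *)

Definition iterate (R : realType) (n : nat) : R -> R := iter n (@picard R) (fun=> 0).

Lemma iterate_admissible (R : realType) (n : nat) : admissible (@iterate R n).
Proof.
elim: n => [|n IHn]; last exact: picard_admissible.
by split; [exact: measurable_cst|move=> s /=; lra].
Qed.

Lemma iterate_nondecreasing (R : realType) (s : R) :
  {homo (fun n => @iterate R n s) : m n / (m <= n)%N >-> m <= n}.
Proof.
apply: (@homo_leq _ (fun n => @iterate R n s) (fun x y => x <= y)) => //.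
- by move=> y x z; exact: le_trans.
move=> n; elim: n s => [|n IHn] s.
  by have [_ /(_ s)/andP[]] := @iterate_admissible R 1.
exact: (picard_homo (iterate_admissible _ n) (iterate_admissible _ n.+1) IHn).
Qed.

(** The iterates increase and stay below 1/2, so they converge pointwise; dominated convergence
    carries the limit through the integral. *)
Lemma picard_fixpoint (R : realType) :
  exists p : R -> R, admissible p /\ forall s, p s = picard p s.
Proof.
pose p (s : R) := sup (range (fun n => @iterate R n s)).
have bnd s : has_ubound (range (fun n => @iterate R n s)).
  by exists (1 / 2) => _ [n _ <-]; have [_ /(_ s)/andP[]] := @iterate_admissible R n.
have cvgp s : iterate n s @[n --> \oo] --> p s.
  by apply: nondecreasing_cvgn => //; exact: iterate_nondecreasing.
have ap : admissible p.
  split.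
    apply: (@measurable_fun_cvg _ _ _ _ (@iterate R)) => //.
    by move=> n; case: (@iterate_admissible R n).
  move=> s; apply/andP; split.
    have [_ /(_ s)/andP[h _]] := @iterate_admissible R 0%N.
    by apply: (le_trans h); apply: ub_le_sup => //; exists 0%N.
  apply: ge_sup; first by exists (iterate 0 s); exists 0%N.
  by move=> _ [n _ <-]; have [_ /(_ s)/andP[]] := @iterate_admissible R n.
exists p; split=> // s.
have cvgT : picard (iterate n) s @[n --> \oo] --> picard p s.
  apply: cvgM; first exact: cvg_cst.
  apply: fine_cvg; rewrite fineK; last first.
    exact/integrable_fin_num/integrable_integrand.
  (* For s <= 0 every primitive vanishes; the dominated convergence argument is run for s > 0. *)
  have [s0|s0] := leP s 0.
    rewrite -[X in _ --> X]fineK; last first.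
      exact/integrable_fin_num/integrable_integrand.
    rewrite -/(Rintegral _ _ _) -/(primitive p s) primitive_le0//.
    rewrite [X in X @ _](_ : _ = fun=> 0%E); first exact: cvg_cst.
    apply/funext => n; rewrite -[LHS]fineK; last first.
      exact/integrable_fin_num/integrable_integrand/iterate_admissible.
    by rewrite -/(Rintegral _ _ _) -/(primitive _ s) primitive_le0.
  (* The dominating function is constant on [0, s]: the bound of [integrand_le] evaluated at t =
     s. *)
  apply: (@dominated_cvg _ _ R (@lebesgue_measure R) `[0, s]%classic (measurable_itv _)
    (fun n => EFin \o integrand (iterate n)) (EFin \o integrand p)
    (EFin \o cst (expR (s / 2) * ((1 + s) / 4)))) => //.
  - move=> n; apply/measurable_EFinP; apply: measurable_funTS.
    exact: (measurable_integrand (iterate_admissible R n)).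
  - move=> t /= _; apply: cvg_EFin; first by apply: nearW.
    apply: cvgM; first exact: cvg_cst.
    apply: cvgD; first exact: cvg_cst.
    apply: cvgM; first exact: cvg_cst.
    exact: (continuous_cvg _ (@slope_rhs_continuous R _) (cvgp t)).
  - apply: continuous_compact_integrable; first exact: segment_compact.
    by apply: continuous_subspaceT => x; exact: cvg_cst.
  - move=> n t /=; rewrite in_itv/= => /andP[t0 ts]; rewrite lee_fin.
    have an := @iterate_admissible R n.
    rewrite ger0_norm ?integrand_ge0//; apply: le_trans (integrand_le an t0) _.
    by apply: ler_pM; rewrite ?expR_ge0 ?ler_expR//; lra.
(* [picard (iterate n)] is [iterate n.+1], so the shifted sequence also tends to [p s]. *)
apply: (cvg_unique _ _ cvgT); first exact: Rhausdorff.
by have := cvgp s; rewrite -(cvg_shiftS (fun n => iterate n s)).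
Qed.

(** * Local calculus in one variable *)

Lemma near_eq_continuous (T V : topologicalType) (f g : T -> V) (x : T) :
  (\forall y \near x, f y = g y) -> {for x, continuous f} -> {for x, continuous g}.
Proof.
move=> fg cf; have fgx : f x = g x by exact: nbhs_singleton fg.
rewrite /prop_for /continuous_at -fgx.
by apply: cvg_trans cf; exact: near_eq_cvg.
Qed.

Lemma is_derive_continuous (R : realType) (f : R -> R) (x df : R) :
  is_derive x 1 f df -> {for x, continuous f}.
Proof. by move=> [d _]; apply/differentiable_continuous/derivable1_diffP. Qed.

Lemma is_derive_near_eq (R : realType) (f g : R -> R) (x df : R) :
  (\forall y \near x, f y = g y) -> is_derive x 1 f df -> is_derive x 1 g df.
Proof.
move=> fg [d v]; split; last by rewrite -v; apply/esym/near_eq_derive => //; exact: oner_neq0.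
by apply: near_eq_derivable d => //; exact: oner_neq0.
Qed.

(** L'Hopital's rule for the difference quotient, with denominator x - c. It supplies the derivative
    of the glued slope at s = 0. *)
Lemma is_derive_of_limit (R : realType) (f df : R -> R) (c : R) :
  (forall x, x != c -> is_derive x 1 f (df x)) -> {for c, continuous f} ->
  {for c, continuous df} -> is_derive c 1 f (df c).
Proof.
move=> fdf cf cdf.
have H : (f x - f c) / (x - c) @[x --> c^'] --> df c.
  apply: (@lhopital _ _ df _ (fun=> 1) (c - 1) (c + 1)).
  - by rewrite in_itv/=; lra.
  - move=> x; rewrite inE => -[_ /eqP xc]; have := fdf x xc => dfx.
    by apply: is_derive_eq; rewrite subr0.
  - by move=> x _; apply: is_derive_eq; rewrite subr0.
  - by rewrite -[X in _ --> X](subrr (f c)); apply: cvgB => //; exact: cvg_cst.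
  - by rewrite -[X in _ --> X](subrr c); apply: cvgB => //; exact: cvg_cst.
  - by move=> x _; exact: oner_neq0.
  - by under eq_fun do rewrite divr1.
have H2 : h^-1 *: (f (h *: 1 + c) - f c) @[h --> 0^'] --> df c.
  have sh : h + c @[h --> (0 : R)^'] --> c^'.
    move=> A [e e0 He]; exists e => //= h /=; rewrite sub0r normrN => he h0.
    apply: He; first by rewrite /= opprD addrCA subrr addr0 normrN.
    by apply: contra_neq h0 => /(congr1 (fun z => z - c)); rewrite addrK subrr.
  apply: cvg_trans (cvg_comp _ _ sh H); apply: near_eq_cvg; apply: nearW => h.
  by rewrite /= addrK /GRing.scale /= mulr1 mulrC.
split; first by apply/cvg_ex; exists (df c).
apply/cvg_lim => //; exact: norm_hausdorff.
Qed.

(** * Regularity of the fixed point for s > 0 and its limits at s = 0 *)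

Section FixedPoint.
Variables (R : realType) (p : R -> R).
Hypothesis (ap : admissible p) (fixp : forall s, p s = picard p s).

Lemma primitive_continuous (s : R) : 0 < s -> {for s, continuous (primitive p)}.
Proof.
move=> s0; have s1 : 0 <= s + 1 by lra.
have := @parameterized_integral_continuous R 0 (s + 1) (integrand p) s1
  (integrable_integrand _ ap).
move=> /continuous_within_itvP[|+ _ _]; first lra.
by apply; rewrite in_itv/=; lra.
Qed.

Lemma primitive_cvg0 : primitive p s @[s --> 0^'+] --> 0.
Proof.
have := @parameterized_integral_continuous R 0 1 (integrand p) ler01
  (integrable_integrand _ ap).
move=> /continuous_within_itvP[|_ + _]; first lra.
by rewrite -[X in _ --> X -> _]/(primitive p 0) primitive_le0.
Qed.

Lemma expR_half_continuous (a : R) : continuous (fun s : R => expR (s * a)).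
Proof.
by move=> s; apply: continuous_comp; [apply: cvgM => //; exact: cvg_cst|exact: continuous_expR].
Qed.

Lemma expR_Nhalf_continuous : continuous (fun s : R => expR (- (s / 2))).
Proof.
move=> s; apply: continuous_comp; last exact: continuous_expR.
by apply: cvgN; apply: cvgM => //; exact: cvg_cst.
Qed.

(** First step of a bootstrap: the primitive of an integrable function is continuous, hence so is
    [p]; then the integrand is continuous and the primitive differentiable. *)
Lemma fixpoint_continuous (s : R) : 0 < s -> {for s, continuous p}.
Proof.
move=> s0; rewrite (_ : p = picard p); last exact/funext.
apply: cvgM; last exact: primitive_continuous.
apply: cvgM; last by apply: cvgV => //; rewrite gt_eqF.
exact: expR_Nhalf_continuous.
Qed.

Lemma is_derive_primitive (s : R) : 0 < s -> is_derive s 1 (primitive p) (integrand p s).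
Proof.
move=> s0; have ci : {for s, continuous (integrand p)}.
  apply: cvgM; first exact: expR_half_continuous.
  apply: cvgD; first exact: cvg_cst.
  apply: cvgM => //.
  exact: (continuous_cvg _ (@slope_rhs_continuous R _) (fixpoint_continuous s0)).
have s1 : s < s + 1 by lra.
have [d v] := continuous_FTC1_closed s1 (integrable_integrand (s + 1) ap) s0 ci.
by split; [exact: d|rewrite -derive1E; exact: v].
Qed.

(** The value is the slope equation solved for p'; the weight e^(s/2) and the added p/2 cancel. *)
Lemma is_derive_fixpoint (s : R) : 0 < s ->
  is_derive s 1 p (p s ^+ 2 - 2 * p s ^+ 3 - (p s - 1 / 4) / s).
Proof.
move=> s0; have dI := is_derive_primitive s0.
have dE : is_derive s 1 (fun t : R => expR (- (t / 2))) (expR (- (s / 2)) * (- 2^-1)).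
  apply: (@is_derive1_comp _ expR (fun t : R => - (t / 2))).
  by apply: is_deriveN; exact: is_derive1_mulr.
have s_neq0 : s != 0 by rewrite gt_eqF.
have dV : is_derive s 1 (fun t : R => t^-1) (- s ^- 2).
  by apply: is_derive_eq; [exact: is_deriveV|rewrite /GRing.scale /= mulr1].
have dEV : is_derive s 1 (fun t : R => expR (- (t / 2)) * t^-1)
    (expR (- (s / 2)) * - s ^- 2 + s^-1 * (expR (- (s / 2)) * - 2^-1)).
  exact: is_deriveM.
have dT : is_derive s 1 (picard p) (expR (- (s / 2)) * s^-1 * integrand p s +
    primitive p s * (expR (- (s / 2)) * - s ^- 2 + s^-1 * (expR (- (s / 2)) * - 2^-1))).
  exact: (is_deriveM dEV dI).
rewrite {1}(_ : p = picard p); last exact/funext.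
apply: (is_derive_eq dT); rewrite /integrand.
have e0 : expR (s / 2) != 0 by rewrite gt_eqF ?expR_gt0.
(* The fixed point equation, solved for the integral, eliminates it from the derivative. *)
have -> : primitive p s = p s * s * expR (s / 2).
  by rewrite fixp /picard expRN; field; rewrite e0 s_neq0.
rewrite expRN /slope_rhs; field.
by rewrite e0 s_neq0.
Qed.

(** By l'Hopital's rule the mean of the integrand over [0, s] tends to the limit of the integrand at
    0, which is 1/4. *)
Lemma fixpoint_cvg0 : p s @[s --> 0^'+] --> (1 / 4 : R).
Proof.
(* The behaviour of [p] at 0 is not known yet, so only its bounds are used. *)
have tg0 : t * slope_rhs (p t) @[t --> 0^'+] --> (0 : R).
  apply: (@squeeze_cvgr _ _ _ _ (fun=> 0) (fun t => t / 4)).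
  - near=> t; have t0 : 0 < t by [].
    by have [_ /(_ t)/slope_rhs_itv/andP[g0 g1]] := ap; apply/andP; split; nra.
  - exact: cvg_cst.
  - apply: cvg_at_right_filter; rewrite -[X in _ --> X](mul0r (4^-1)).
    by apply: cvgM => //; exact: cvg_cst.
have iq : integrand p t @[t --> 0^'+] --> (1 / 4 : R).
  have -> : 1 / 4 = expR (0 / 2) * (1 / 4 + 0) :> R.
    by rewrite mul0r expR0 !mul1r addr0.
  apply: cvgM; first exact/cvg_at_right_filter/expR_half_continuous.
  by apply: cvgD; [exact: cvg_cst|exact: tg0].
have : primitive p t / t @[t --> 0^'+] --> (1 / 4 : R).
  apply: (@lhopital_at_right _ _ (integrand p) id (fun=> 1) 0 1) => //.
  - by move=> x; rewrite in_itv/= => /andP[x0 _]; exact: is_derive_primitive.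
  - exact: primitive_cvg0.
  - exact: cvg_at_right_filter.
  - by apply: cvg_trans iq; apply: near_eq_cvg; apply: nearW => x; rewrite divr1.
move=> H; rewrite (_ : p = picard p); last exact/funext.
have -> : 1 / 4 = expR (- (0 / 2)) * (1 / 4) :> R.
  by rewrite mul0r oppr0 expR0 !mul1r.
rewrite (_ : picard p = fun t => expR (- (t / 2)) * (primitive p t / t)).
  by apply: cvgM; [exact/cvg_at_right_filter/expR_Nhalf_continuous|exact: H].
by apply/funext => t; rewrite /picard -mulrA [_^-1 * _]mulrC.
Unshelve. all: by end_near. Qed.

(** Multiplying numerator and denominator by s frees the differentiated numerator of the singular
    term: it becomes s (p^2 - 2 p^3) over 2 s, with limit (1/16 - 1/32) / 2. *)
Lemma fixpoint_slope_cvg0 : (p s - 1 / 4) / s @[s --> 0^'+] --> (1 / 64 : R).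
Proof.
have H : (s * (p s - 1 / 4)) / s ^+ 2 @[s --> 0^'+] --> (1 / 64 : R).
  apply: (@lhopital_at_right _ _ (fun s => s * (p s ^+ 2 - 2 * p s ^+ 3)) _
    (fun s => 2 * s) 0 1) => //.
  - move=> x; rewrite in_itv/= => /andP[x0 _]; have dp := is_derive_fixpoint x0.
    apply: is_derive_eq; rewrite /GRing.scale /= subr0; field.
    by rewrite gt_eqF.
  - move=> x _; apply: is_derive_eq; rewrite /GRing.scale /=; ring.
  - rewrite -[X in _ --> X](mul0r (1 / 4 - 1 / 4)); apply: cvgM.
      exact: cvg_at_right_filter.
    by apply: cvgB; [exact: fixpoint_cvg0|exact: cvg_cst].
  - rewrite -[X in _ --> X](expr0n _ 2); apply: cvg_at_right_filter.
    exact: exprn_continuous.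
  - by move=> x; rewrite in_itv/= => /andP[x0 _]; rewrite mulf_neq0// gt_eqF.
  have -> : 1 / 64 = (slope_rhs (1 / 4) - (1 / 4) / 2) / 2 :> R.
    by rewrite /slope_rhs; field.
  apply: (@cvg_trans _ ((slope_rhs (p s) - p s / 2) / 2 @[s --> 0^'+])).
    apply: near_eq_cvg; near=> s; have s0 : 0 < s by [].
    by rewrite /slope_rhs; field; rewrite gt_eqF.
  apply: cvgM; last exact: cvg_cst.
  apply: cvgB; last by apply: cvgM; [exact: fixpoint_cvg0|exact: cvg_cst].
  exact: (continuous_cvg _ (@slope_rhs_continuous R _) fixpoint_cvg0).
apply: cvg_trans H; apply: near_eq_cvg; near=> s; have s0 : 0 < s by [].
by field; rewrite gt_eqF.
Unshelve. all: by end_near. Qed.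

End FixedPoint.

(** Two-sided derivatives at 0 require values for s < 0, but the bounds and the equation concern s
    >= 0 only. At s = 0 the equation says p = 1/4. *)
Lemma bowl_slope (R : realType) : exists p dp : R -> R,
  [/\ forall s : R, is_derive s 1 p (dp s), continuous dp,
      forall s : R, 0 <= s -> 0 <= p s <= 1 / 2
    & forall s : R, 0 <= s ->
        4 * s * dp s = (1 - 2 * p s) * (1 + 4 * s * p s ^+ 2) - 2 * p s].
Proof.
have [p [ap fixp]] := picard_fixpoint R.
(* Extending by the tangent at [0], of slope [1/64], keeps the slope C^1, hence
   the bowl C^2 across its axis. *)
pose q (s : R) := if 0 < s then p s else 1 / 4 + s / 64.
pose dq (s : R) := if 0 < s then p s ^+ 2 - 2 * p s ^+ 3 - (p s - 1 / 4) / s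
  else 1 / 64.
have qpos (s : R) : 0 < s -> \forall t \near s, p t = q t.
  move=> s0; near=> t; rewrite /q ifT//; near: t; exact: lt_nbhsr.
have qneg (s : R) : s < 0 -> \forall t \near s, 1 / 4 + t / 64 = q t.
  move=> s0; near=> t; rewrite /q ifF//; apply/negbTE; rewrite -leNgt.
  by apply: ltW; near: t; exact: lt_nbhsl.
have d0 (s : R) : s != 0 -> is_derive s 1 q (dq s).
  rewrite neq_lt => /orP[s0|s0].
    apply: is_derive_near_eq (qneg s s0) _.
    rewrite /dq ifF ?le_gtF ?(ltW s0)//; have := is_derive1_mulr (64^-1) s => H.
    by apply: is_derive_eq; rewrite add0r div1r.
  apply: is_derive_near_eq (qpos s s0) _.
  by rewrite /dq s0; exact: is_derive_fixpoint.
have cq0 : {for 0, continuous q}.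
  apply/left_right_continuousP; rewrite {2 4}/q ltxx mul0r addr0; split.
    apply: (@cvg_trans _ (1 / 4 + t / 64 @[t --> 0^'-])).
      apply: near_eq_cvg; near=> s; rewrite /q ifF//; apply/negbTE.
      by rewrite -leNgt ltW.
    apply: cvg_at_left_filter; rewrite -[X in _ --> X]addr0; apply: cvgD.
      exact: cvg_cst.
    by rewrite -[X in _ --> X](mul0r (64^-1)); apply: cvgM => //; exact: cvg_cst.
  apply: cvg_trans (fixpoint_cvg0 ap fixp); apply: near_eq_cvg; near=> s.
  by rewrite /q ifT.
have cdq0 : {for 0, continuous dq}.
  apply/left_right_continuousP; rewrite {2 4}/dq ltxx; split.
    apply: (@cvg_trans _ ((1 / 64 : R) @[t --> 0^'-])); last exact: cvg_cst.
    apply: near_eq_cvg; near=> s; rewrite /dq ifF//; apply/negbTE.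
    by rewrite -leNgt ltW.
  (* From the right the derivative tends to 1/32 - 1/64, which matches the slope of the tangent on
     the left. *)
  have -> : 1 / 64 = (slope_rhs (1 / 4) - (1 / 4) / 2) - 1 / 64 :> R.
    by rewrite /slope_rhs; field.
  apply: (@cvg_trans _ ((slope_rhs (p s) - p s / 2) - (p s - 1 / 4) / s @[s --> 0^'+])).
    apply: near_eq_cvg; near=> s; rewrite /dq ifT// /slope_rhs.
    by congr (_ - _); ring.
  have pc := fixpoint_cvg0 ap fixp.
  apply: cvgB; last exact: fixpoint_slope_cvg0.
  apply: cvgB; last by apply: cvgM => //; exact: cvg_cst.
  exact: (continuous_cvg _ (@slope_rhs_continuous R _) pc).
have dall (s : R) : is_derive s 1 q (dq s).
  by have [->|s0] := eqVneq s 0; [exact: is_derive_of_limit|exact: d0].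
exists q, dq; split => //.
- move=> s; have [s0|s0|->//] := ltgtP s 0.
    apply: (@near_eq_continuous R R (fun=> (1 / 64 : R)) dq s); last exact: cvg_cst.
    near=> t; rewrite /dq ifF//; apply/negbTE; rewrite -leNgt.
    by apply: ltW; near: t; exact: lt_nbhsl.
  apply: (@near_eq_continuous R R
    (fun t => (slope_rhs (p t) - p t / 2) - (p t - 1 / 4) / t) dq s).
    near=> t; rewrite /dq ifT; last by near: t; exact: lt_nbhsr.
    by rewrite /slope_rhs; congr (_ - _); ring.
  have pc := fixpoint_continuous ap fixp s0.
  apply: cvgB.
    apply: cvgB; last by apply: cvgM => //; exact: cvg_cst.
    exact: (continuous_cvg _ (@slope_rhs_continuous R _) pc).
  apply: cvgM; first by apply: cvgB => //; exact: cvg_cst.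
  by apply: cvgV => //; rewrite gt_eqF.
- move=> s; rewrite /q; case: ifP => [s0 _|/negbT]; first by case: ap => _.
  rewrite -leNgt => s1 s2; have -> : s = 0 by lra.
  by rewrite ?mul0r ?mulr0; lra.
- move=> s; rewrite /q /dq; case: ifP => [s0 _|/negbT].
    by field; rewrite gt_eqF.
  rewrite -leNgt => s1 s2; have -> : s = 0 by lra.
  by rewrite ?mul0r ?mulr0; lra.
Unshelve. all: by end_near. Qed.

Lemma bowl_profile (R : realType) : exists G p dp : R -> R,
  [/\ forall s : R, 0 <= s -> is_derive s 1 G (p s),
      forall s : R, is_derive s 1 p (dp s), continuous dp,
      forall s : R, 0 <= s -> 0 <= p s <= 1 / 2
    & forall s : R, 0 <= s ->
        4 * s * dp s = (1 - 2 * p s) * (1 + 4 * s * p s ^+ 2) - 2 * p s].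
Proof.
have [p [dp [pdp cdp pb ode]]] := bowl_slope R.
(* Integrating from -1 makes s = 0 an interior point, so the derivative there is two-sided. *)
exists (fun s => \int[lebesgue_measure]_(t in `[-1, s]) p t), p, dp; split=> // s s0.
have cp : continuous p by move=> x; exact: is_derive_continuous (pdp x).
have intp : lebesgue_measure.-integrable `[-1, s + 1] (EFin \o p).
  apply: continuous_compact_integrable; first exact: segment_compact.
  exact: continuous_subspaceT.
have s1 : s < s + 1 by lra.
have s2 : -1 < s by lra.
have [d v] := continuous_FTC1_closed s1 intp s2 (cp s).
by split; [exact: d|rewrite -derive1E; exact: v].
Qed.

(** * Second order conditions and viscosity solutions *)

(** A mean value theorem for increments of either sign, as they occur along a coordinate
    direction. *)
Lemma MVT_sym (R : realType) (f df : R -> R) (r : R) :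
  (forall t : R, `|t| <= `|r| -> is_derive t 1 f (df t)) ->
  exists2 c, `|c| <= `|r| & f r - f 0 = df c * r.
Proof.
move=> fdf.
have cf (a b : R) : (forall t, a <= t <= b -> `|t| <= `|r|) ->
    {within `[a, b], continuous f}.
  move=> ab; apply: derivable_within_continuous => t; rewrite in_itv/= => tab.
  by case: (fdf t (ab _ tab)).
have [r0|r0|->] := ltgtP r 0; last by exists 0; rewrite ?subrr ?mulr0.
- have rb t : r <= t <= 0 -> `|t| <= `|r|.
    by move=> /andP[rt t0]; rewrite !ler0_norm// ?lerN2//; lra.
  have [|c cr e] := @MVT R f df _ _ r0 _ (cf _ _ rb).
    by move=> t; rewrite in_itv/= => /andP[rt t0]; apply/fdf/rb; rewrite !ltW.
  move: cr; rewrite in_itv/= => /andP[rc c0].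
  by exists c; [apply/rb; rewrite !ltW|lra].
- have rb t : 0 <= t <= r -> `|t| <= `|r|.
    by move=> /andP[rt t0]; rewrite !ger0_norm//; lra.
  have [|c cr e] := @MVT R f df _ _ r0 _ (cf _ _ rb).
    by move=> t; rewrite in_itv/= => /andP[rt t0]; apply/fdf/rb; rewrite !ltW.
  move: cr; rewrite in_itv/= => /andP[rc c0].
  by exists c; [apply/rb; rewrite !ltW|lra].
Qed.

(** The two difference quotients coincide after reordering the sums, so directional derivatives
    reduce to one variable. *)
Lemma is_derive_line (R : realType) (V : normedModType R) (f : V -> R) (z v : V) (t l : R) :
  is_derive t 1 (fun s : R => f (z + s *: v)) l <-> is_derive (z + t *: v) v f l.
Proof.
have E : (fun h : R => h^-1 *: (f (z + (h *: 1 + t) *: v) - f (z + t *: v))) =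
         (fun h : R => h^-1 *: (f (h *: v + (z + t *: v)) - f (z + t *: v))).
  by apply/funext => h; rewrite [h *: 1]mulr1 scalerDl addrCA.
split=> -[d e]; split.
- by move: d; rewrite /derivable /= E.
- by rewrite -e /derive /= E.
- by rewrite /derivable /= E.
- by rewrite -e /derive /= E.
Qed.

(** The base point [z h] may move with h. The mean value theorem turns the quotient into [a] times
    the partial derivative at a point that tends to [x], where that derivative is continuous. *)
Lemma cvg_partial_difference (R : realType) (n : nat) (f : 'rV[R]_n -> R) (k : 'I_n)
    (x : 'rV[R]_n) (z : R -> 'rV[R]_n) (a : R) :
  (\forall y \near x, derivable f y (delta_mx 0 k)) ->
  {for x, continuous (partial k f)} -> z h @[h --> 0^'] --> x ->
  h^-1 * (f (z h + (h * a) *: delta_mx 0 k) - f (z h)) @[h --> 0^'] -->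
    a * partial k f x.
Proof.
move=> df cf zx; set e := delta_mx 0 k.
apply/cvgrPdist_le => eps eps0.
have a1 : 0 < `|a| + 1 by rewrite ltr_pwDr.
have ep1 : 0 < eps / (`|a| + 1) by rewrite divr_gt0.
(* The tolerance eps / (|a| + 1) absorbs the factor [a]; adding 1 avoids a division by zero. *)
have near_x : \forall y \near x, derivable f y e /\
    `|partial k f x - partial k f y| <= eps / (`|a| + 1).
  by apply: filterI => //; move/cvgrPdist_le : cf; exact.
have [d d0 xd] : exists2 d, 0 < d & forall y, `|x - y| < d -> derivable f y e /\
    `|partial k f x - partial k f y| <= eps / (`|a| + 1).
  by move/nbhs_normP : near_x => [d d0 H]; exists d => // y; exact: H.
have e1 : 0 < `|e| + 1 by rewrite ltr_pwDr.
near=> h.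
have h0 : h != 0 by near: h; exact: nbhs_dnbhs_neq.
have zh : `|x - z h| < d / 2.
  by near: h; move/cvgrPdist_lt : zx; apply; rewrite divr_gt0.
have he : `|h * a| * `|e| < d / 2.
  have : `|h| < d / 2 / ((`|a| + 1) * (`|e| + 1)).
    by near: h; apply: dnbhs0_lt; rewrite divr_gt0 ?mulr_gt0// divr_gt0.
  rewrite ltr_pdivlMr ?mulr_gt0//; apply: le_lt_trans.
  by rewrite normrM -mulrA ler_wpM2l// ler_pM// lerDl.
have near_z t : `|t| <= `|h * a| -> `|x - (z h + t *: e)| < d.
  move=> th; rewrite opprD addrA (splitr d).
  apply: le_lt_trans (ler_normB _ _) _; apply: ltrD => //.
  by rewrite normrZ; apply: le_lt_trans he; rewrite ler_wpM2r.
have [t th|c ch] := @MVT_sym R (fun t => f (z h + t *: e))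
  (fun t => partial k f (z h + t *: e)) (h * a).
  by apply/is_derive_line; split => //; case: (xd _ (near_z _ th)).
rewrite scale0r addr0 => ->.
have [_ Hc] := xd _ (near_z _ ch).
have -> : h^-1 * (partial k f (z h + c *: e) * (h * a)) = a * partial k f (z h + c *: e).
  by field.
rewrite -mulrBr normrM.
apply: (@le_trans _ _ (`|a| * (eps / (`|a| + 1)))); first by rewrite ler_wpM2l.
by rewrite mulrA ler_pdivrMr// mulrDr mulr1 [_ * eps]mulrC lerDl ltW.
Unshelve. all: by end_near. Qed.

(** The increment along [v] is split into one increment per coordinate; [w k] is [v] truncated to
    its first k coordinates, so each piece starts from a base point that moves with h. *)
Lemma is_derive_partials (R : realType) (n : nat) (f : 'rV[R]_n -> R) (x v : 'rV[R]_n) :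
  (\forall y \near x, forall i, derivable f y (delta_mx 0 i)) ->
  (forall i, {for x, continuous (partial i f)}) ->
  is_derive x v f (\sum_(i < n) v 0 i * partial i f x).
Proof.
move=> df cf.
pose w (k : nat) : 'rV[R]_n := \sum_(i < n | (i < k)%N) v 0 i *: delta_mx 0 i.
have H k : (k <= n)%N -> h^-1 * (f (x + h *: w k) - f x) @[h --> 0^'] -->
    \sum_(i < n | (i < k)%N) v 0 i * partial i f x.
  elim: k => [_|k IH kn].
    rewrite big_pred0; last by move=> i; rewrite ltn0.
    apply: (@cvg_trans _ ((0 : R) @[h --> (0 : R)^'])); last exact: cvg_cst.
    apply: near_eq_cvg; apply: nearW => h.
    by rewrite /w big_pred0 ?scaler0 ?addr0 ?subrr ?mulr0// => i; rewrite ltn0.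
  pose k' := Ordinal kn.
  have sumS (V : nmodType) (F : 'I_n -> V) : \sum_(i < n | (i < k.+1)%N) F i =
      \sum_(i < n | (i < k)%N) F i + F k'.
    rewrite (bigD1 k')//= addrC; congr (_ + _); apply: eq_bigl => i.
    by rewrite ltnS ltn_neqAle andbC.
  rewrite sumS.
  have wS h : x + h *: w k.+1 = x + h *: w k + (h * v 0 k') *: delta_mx 0 k'.
    by rewrite /w sumS scalerDr scalerA addrA.
  apply: (@cvg_trans _ (h^-1 * (f (x + h *: w k) - f x) +
     h^-1 * (f (x + h *: w k + (h * v 0 k') *: delta_mx 0 k') - f (x + h *: w k))
     @[h --> 0^'])).
    by apply: near_eq_cvg; apply: nearW => h; rewrite wS; ring.
  apply: cvgD; first exact/IH/ltnW.
  apply: cvg_partial_difference => //.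
    by near=> y; apply: (near df y).
  rewrite -[X in _ --> X]addr0; apply: cvgD; first exact: cvg_cst.
  rewrite -[X in _ --> X](scale0r (w k)).
  by apply: cvgZ; [apply: cvg_within|exact: cvg_cst].
have wn : w n = v.
  by rewrite /w [RHS]row_sum_delta; apply: eq_bigl => i; rewrite ltn_ord.
have := H n (leqnn n); rewrite wn (eq_bigl xpredT); last by move=> i; rewrite ltn_ord.
move=> Hn.
have E : h^-1 *: (f (h *: v + x) - f x) @[h --> 0^'] --> \sum_(i < n) v 0 i * partial i f x.
  by apply: cvg_trans Hn; apply: near_eq_cvg; apply: nearW => h; rewrite [_ + x]addrC.
split; first by apply/cvg_ex; eexists; exact: E.
by apply/cvg_lim; [exact: norm_hausdorff|exact: E].
Unshelve. all: by end_near. Qed.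

Definition quad (R : realType) (n : nat) (H : 'M[R]_n) (v : 'rV[R]_n) : R :=
  \sum_(i < n) \sum_(j < n) v 0 i * v 0 j * H i j.

(** * First and second derivatives of a C^2 function along a line *)

Section Lines.
Variables (R : realType) (n : nat) (Om : set 'rV[R]_n) (u : 'rV[R]_n -> R).
Hypotheses (oOm : open Om) (u2 : C2_on Om u).
Variables (x v : 'rV[R]_n).

Let near_Om (y : 'rV[R]_n) : Om y -> \forall z \near y, Om z.
Proof. by move=> Oy; exact: open_nbhs_nbhs. Qed.

Lemma near_line (t : R) : Om (x + t *: v) -> \forall s \near t, Om (x + s *: v).
Proof.
move=> Omt; have : (x + s *: v) @[s --> t] --> x + t *: v.
  by apply: cvgD; [exact: cvg_cst|apply: cvgZ => //; exact: cvg_cst].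
by move=> /(_ _ (near_Om Omt)).
Qed.

Lemma is_derive_line_C2 (t : R) : Om (x + t *: v) ->
  is_derive t 1 (fun s => u (x + s *: v)) (dot v (grad u (x + t *: v))).
Proof.
move=> Omt; apply/is_derive_line.
rewrite (_ : dot _ _ = \sum_(i < n) v 0 i * partial i u (x + t *: v)); last first.
  by apply: eq_bigr => i _; rewrite mxE.
apply: is_derive_partials; last by move=> i; have [_ /(_ i)[]] := u2 Omt.
by apply: filterS (near_Om Omt) => y /u2[_ H1 _] i; case: (H1 i).
Qed.

Lemma is_derive2_line_C2 (t : R) : Om (x + t *: v) ->
  is_derive t 1 (fun s => dot v (grad u (x + s *: v))) (quad (hess u (x + t *: v)) v).
Proof.
move=> Omt.
have d i : is_derive t 1 (fun s => partial i u (x + s *: v))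
    (\sum_(j < n) v 0 j * hess u (x + t *: v) i j).
  apply/is_derive_line.
  have -> : \sum_(j < n) v 0 j * hess u (x + t *: v) i j =
      \sum_(j < n) v 0 j * partial j (partial i u) (x + t *: v).
    by apply: eq_bigr => j _; rewrite mxE.
  apply: is_derive_partials; last by move=> j; have [_ _ /(_ i j)[]] := u2 Omt.
  by apply: filterS (near_Om Omt) => y /u2[_ _ H1] j; case: (H1 i j).
rewrite (_ : (fun s => _) = \sum_(i < n) (fun s => v 0 i * partial i u (x + s *: v))).
  apply: is_derive_eq; apply: eq_bigr => i _; rewrite /GRing.scale /= mulr_sumr.
  by apply: eq_bigr => j _; rewrite mulrA.
by apply/funext => s; rewrite fct_sumE; apply: eq_bigr => i _; rewrite mxE.
Qed.

End Lines.

(** If [g2] were negative, [dg] would be negative just to the right of 0, and the mean value theorem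
    would put [g] below its minimum. *)
Lemma second_order_min (R : realType) (g dg : R -> R) (g2 : R) :
  (\forall t \near (0 : R), is_derive (t : R) 1 g (dg t)) -> is_derive (0 : R) 1 dg g2 ->
  (\forall t \near (0 : R), g 0 <= g t) -> dg 0 = 0 /\ 0 <= g2.
Proof.
move=> near_d dg2 near_min.
have [e e0 He] : exists2 e, 0 < e & forall t : R, `|t| < e ->
    is_derive t 1 g (dg t) /\ g 0 <= g t.
  have /nbhs_normP[e e0 H] : \forall t \near (0 : R), is_derive (t : R) 1 g (dg t) /\ g 0 <= g t.
    exact: filterI.
  by exists e => // t te; apply: H; rewrite /= sub0r normrN.
have itvE (t : R) : t \in `]-e, e[ -> `|t| < e by rewrite in_itv/= ltr_norml.
have zeroE : (0 : R) \in `]-e, e[ by rewrite in_itv/=; lra.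
have dg0 : dg 0 = 0.
  have [_ <-] := (He 0 (itvE _ zeroE)).1.
  have ee : - e <= e by lra.
  have [|//|_ ->//] := @derive1_at_min R g (- e) e 0 ee _ zeroE.
  - by move=> t /itvE/He[[]].
  - by move=> t /itvE/He[].
split=> //; rewrite leNgt; apply/negP => g2_lt0.
have : h^-1 *: (dg (h *: 1 + 0) - dg 0) @[h --> (0 : R)^'] --> g2.
  by case: dg2 => d <-; exact: d.
move=> /cvgr_lt/(_ _ g2_lt0)[d d0 Hd].
pose t := Num.min d e / 2.
have tt : 0 < t by rewrite divr_gt0// lt_min d0.
have td : t < d.
  have : Num.min d e <= d by rewrite ge_min lexx.
  by move: tt; rewrite /t; lra.
have te : t < e.
  have : Num.min d e <= e by rewrite ge_min lexx orbT.
  by move: tt; rewrite /t; lra.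
have inE c : 0 <= c <= t -> `|c| < e.
  by move=> /andP[c0 ct]; rewrite ger0_norm//; lra.
have [||c + gE] := @MVT R g dg 0 t tt.
- move=> x; rewrite in_itv/= => /andP[x0 xt].
  by case: (He x) => //; apply: inE; rewrite !ltW.
- apply: derivable_within_continuous => x; rewrite in_itv/= => x0t.
  by case: (He x (inE _ x0t)) => -[].
rewrite in_itv/= => /andP[c0 ct].
have : dg c < 0.
  have := Hd c; rewrite /= sub0r normrN gtr0_norm// => /(_ (lt_trans ct td)).
  rewrite gt_eqF// => /(_ isT).
  by rewrite dg0 subr0 addr0 [c *: 1]mulr1 /GRing.scale /= pmulr_rlt0// invr_gt0.
have tE : `|t| < e by apply: inE; rewrite ltW //= lexx.
have [_] := He t tE.
by rewrite -subr_ge0 gE subr0 => + dgc; rewrite pmulr_lge0// leNgt dgc.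
Qed.

Lemma sqr_enorm (R : realType) (n : nat) (x : 'rV[R]_n) : enorm x ^+ 2 = dot x x.
Proof.
by rewrite sqr_sqrtr// sumr_ge0// => i _; rewrite -expr2 sqr_ge0.
Qed.

(* [a = 1 - p^T p / |p|^2] is a projection, so [tr (a H) = tr (a^T H a)]. *)
Lemma mc_op_ge0 (R : realType) (n : nat) (p : 'rV[R]_n) (H : 'M[R]_n) :
  p != 0 -> (forall v, 0 <= quad H v) -> 0 <= mc_op (enorm p ^+ 2) p H.
Proof.
move=> p0 H0; set c := enorm p ^+ 2.
have cE : c = \sum_k p 0 k * p 0 k.
  by rewrite /c sqr_enorm.
have c0 : c != 0.
  apply: contra p0 => c0; apply/eqP/rowP => i; rewrite mxE.
  have : p 0 i * p 0 i = 0.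
    apply/eqP; move: c0; rewrite cE psumr_eq0; last by move=> k _; rewrite -expr2 sqr_ge0.
    by move=> /allP/(_ i (mem_index_enum _)).
  by move/eqP; rewrite mulf_eq0 orbb => /eqP.
pose a (i j : 'I_n) : R := (i == j)%:R - p 0 i * p 0 j / c.
have aE i j : a i j = \sum_k a k i * a k j.
  (* The product is expanded; as the p_k^2 sum to c, the last term cancels one of the two middle
     ones. *)
  transitivity (\sum_k ((k == i)%:R * (k == j)%:R - (k == i)%:R * (p 0 k * p 0 j / c)
      - (k == j)%:R * (p 0 k * p 0 i / c) + (p 0 k * p 0 k) * (p 0 i * p 0 j / c ^+ 2))).
    rewrite big_split/= sumrB sumrB -mulr_suml -cE.
    rewrite (bigD1 i)//= eqxx big1 => [|k /negbTE->]; last by rewrite mul0r.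
    rewrite (bigD1 i)//= eqxx big1 => [|k /negbTE->]; last by rewrite mul0r.
    rewrite (bigD1 j)//= eqxx big1 => [|k /negbTE->]; last by rewrite mul0r.
    by rewrite /a /=; field.
  by apply: eq_bigr => k _; rewrite /a; field.
have -> : mc_op c p H = \sum_k quad H (\row_i a k i).
  rewrite /mc_op /quad exchange_big/=.
  transitivity (\sum_j \sum_i \sum_k a k i * a k j * H i j).
    by apply: eq_bigr => j _; apply: eq_bigr => i _; rewrite -/(a i j) aE mulr_suml.
  rewrite exchange_big/=; under eq_bigr do rewrite exchange_big/=.
  rewrite exchange_big/=; apply: eq_bigr => k _; apply: eq_bigr => i _.
  by apply: eq_bigr => j _; rewrite !mxE.
by apply: sumr_ge0 => k _; exact: H0.
Qed.

Lemma mc_opB (R : realType) (n : nat) (c : R) (p : 'rV[R]_n) (H K : 'M[R]_n) :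
  mc_op c p (H - K) = mc_op c p H - mc_op c p K.
Proof.
rewrite /mc_op -sumrB; apply: eq_bigr => i _; rewrite -sumrB.
by apply: eq_bigr => j _; rewrite !mxE mulrBr.
Qed.

Lemma quadB (R : realType) (n : nat) (v : 'rV[R]_n) (H K : 'M[R]_n) :
  quad (H - K) v = quad H v - quad K v.
Proof.
rewrite /quad -sumrB; apply: eq_bigr => i _; rewrite -sumrB.
by apply: eq_bigr => j _; rewrite !mxE mulrBr.
Qed.

Lemma dot_delta (R : realType) (n : nat) (i : 'I_n) (x : 'rV[R]_n) :
  dot (delta_mx 0 i) x = x 0 i.
Proof.
rewrite /dot (bigD1 i)//= mxE !eqxx mul1r big1 ?addr0// => j /negbTE ji.
by rewrite mxE eqxx ji mul0r.
Qed.

(** Restricted to any line through [x], f - g has a local minimum, to which the one variable test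
    applies. *)
Lemma touching_order (R : realType) (n : nat) (Om : set 'rV[R]_n)
    (f g : 'rV[R]_n -> R) (x : 'rV[R]_n) :
  open Om -> C2_on Om f -> C2_on Om g -> Om x ->
  (\forall y \near x, f x - g x <= f y - g y) ->
  grad f x = grad g x /\ forall v, 0 <= quad (hess f x - hess g x) v.
Proof.
move=> oOm f2 g2 Omx fg.
have key v : dot v (grad f x) = dot v (grad g x) /\
    0 <= quad (hess f x - hess g x) v.
  have Om0 : Om (x + 0 *: v) by rewrite scale0r addr0.
  have df2 := is_derive2_line_C2 oOm f2 Om0.
  have dg2 := is_derive2_line_C2 oOm g2 Om0.
  have [||d0 d2] := @second_order_min R
    (fun t => f (x + t *: v) - g (x + t *: v))
    (fun t => dot v (grad f (x + t *: v)) - dot v (grad g (x + t *: v)))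
    (quad (hess f (x + 0 *: v)) v - quad (hess g (x + 0 *: v)) v).
  - apply: filterS (near_line oOm Om0) => t Omt.
    by apply: is_deriveB; exact: is_derive_line_C2 Omt.
  - rewrite scale0r addr0.
    have : (x + t *: v) @[t --> (0 : R)] --> x.
      rewrite -[X in _ --> X]addr0; apply: cvgD; first exact: cvg_cst.
      by rewrite -[X in _ --> X](scale0r v); apply: cvgZ => //; exact: cvg_cst.
    by move=> /(_ _ fg).
  move: d0 d2; rewrite scale0r addr0 -quadB => /eqP; rewrite subr_eq0 => /eqP.
  by [].
split; last by move=> v; case: (key v).
by apply/rowP => i; have [] := key (delta_mx 0 i); rewrite !dot_delta.
Qed.

(** A test function shares the nonzero gradient of [u] at the touching point, so the clause for zero
    gradients is vacuous; in the other clause the Hessians are ordered and [mc_op_ge0] compares the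
    operators. *)
Lemma classical_viscosity (R : realType) (n : nat) (Om : set 'rV[R]_n)
    (u : 'rV[R]_n -> R) :
  open Om -> classical_solution 0 Om u -> (forall x, Om x -> grad u x != 0) ->
  viscosity_solution Om u.
Proof.
move=> oOm [u2 eqn] gu0; split=> phi x phi2 Omx near_x.
- have [|gE Hge0] := touching_order oOm phi2 u2 Omx.
    by apply: filterS near_x => y; rewrite -subr_ge0 => h; rewrite -subr_ge0; lra.
  split; last by rewrite gE => g0; have := gu0 x Omx; rewrite g0 eqxx.
  move=> _; have := eqn x Omx; rewrite add0r => <-.
  by rewrite gE -subr_ge0 -mc_opB; apply: mc_op_ge0 => //; exact: gu0.
- have [|gE Hge0] := touching_order oOm u2 phi2 Omx; first exact: near_x.
  split; last by rewrite -gE => g0; have := gu0 x Omx; rewrite g0 eqxx.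
  move=> _; have := eqn x Omx; rewrite add0r => <-.
  by rewrite -gE -subr_ge0 -mc_opB; apply: mc_op_ge0 => //; exact: gu0.
Qed.

(** * Smooth solutions and rotational symmetry *)

Section Pointwise.
Variables (R : realType) (V : normedModType R) (f g : V -> R) (x v : V) (df dg : R).
Hypotheses (fdf : is_derive x v f df) (gdg : is_derive x v g dg).

Lemma is_derive_add : is_derive x v (fun y => f y + g y) (df + dg).
Proof. exact: is_deriveD. Qed.

Lemma is_derive_mul : is_derive x v (fun y => f y * g y) (f x * dg + g x * df).
Proof. exact: is_deriveM. Qed.

Lemma is_derive_scale (k : R) : is_derive x v (fun y => k * f y) (k * df).
Proof. exact: is_deriveZ. Qed.

End Pointwise.

Section PointwiseContinuity.
Variables (R : realType) (T : topologicalType) (f g : T -> R) (x : T).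
Hypotheses (cf : {for x, continuous f}) (cg : {for x, continuous g}).

Lemma continuous_add : {for x, continuous (fun y => f y + g y)}.
Proof. exact: cvgD. Qed.

Lemma continuous_mul : {for x, continuous (fun y => f y * g y)}.
Proof. exact: cvgM. Qed.

Lemma continuous_scale (k : R) : {for x, continuous (fun y => k * f y)}.
Proof. by apply: cvgM; [exact: cvg_cst|exact: cf]. Qed.

Lemma continuous_comp_real (k : R -> R) : {for f x, continuous k} ->
  {for x, continuous (fun y => k (f y))}.
Proof. exact: continuous_comp. Qed.

End PointwiseContinuity.

Arguments continuous_scale {R T f x} cf k.

Lemma is_derive_near_eq_dir (R : realType) (V : normedModType R) (f g : V -> R)
    (x v : V) (l : R) : v != 0 ->
  (\forall y \near x, f y = g y) -> is_derive x v f l -> is_derive x v g l.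
Proof.
move=> v0 fg [d e]; split; first exact: near_eq_derivable d.
by rewrite -e; apply/esym/near_eq_derive.
Qed.

Lemma delta_row_neq0 (R : realType) (n : nat) (i : 'I_n) :
  delta_mx 0 i != 0 :> 'rV[R]_n.
Proof.
apply/eqP => /rowP/(_ i); rewrite !mxE !eqxx => /eqP.
by rewrite oner_eq0.
Qed.

Lemma is_derive_comp_real (R : realType) (V : normedModType R) (f : R -> R)
    (g : V -> R) (x v : V) (a b : R) :
  is_derive (g x) 1 f a -> is_derive x v g b -> is_derive x v (f \o g) (a * b).
Proof.
have xE : x = x + 0 *: v by rewrite scale0r addr0.
rewrite xE => df /is_derive_line dg; apply/is_derive_line.
exact: (is_derive1_comp df dg).
Qed.

Lemma is_derive_coord (R : realType) (n : nat) (i : 'I_n) (x v : 'rV[R]_n) :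
  is_derive x v (fun y : 'rV[R]_n => y 0 i) (v 0 i).
Proof.
rewrite -[x]addr0 -(scale0r v); apply/is_derive_line.
have -> : (fun s : R => (x + s *: v) 0 i) = (fun s : R => x 0 i + s * v 0 i).
  by apply/funext => s; rewrite !mxE.
have H := is_derive1_mulr (v 0 i) 0.
have H0 := @is_derive_cst R R R (x 0 i) 0 1.
by have := is_derive_add H0 H; rewrite add0r.
Qed.

(** The partial derivatives of [u] agree with the explicit [g] and [h] only on [Om]; since [Om] is
    open they agree near each of its points, and regularity transfers. *)
Lemma C2_intro (R : realType) (n : nat) (Om : set 'rV[R]_n) (u : 'rV[R]_n -> R)
    (g : 'rV[R]_n -> 'rV[R]_n) (h : 'rV[R]_n -> 'M[R]_n) : open Om ->
  (forall x, Om x -> {for x, continuous u}) ->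
  (forall x i, Om x -> is_derive x (delta_mx 0 i) u (g x 0 i)) ->
  (forall x i, Om x -> {for x, continuous (fun y => g y 0 i)}) ->
  (forall x i j, Om x -> is_derive x (delta_mx 0 j) (fun y => g y 0 i) (h x i j)) ->
  (forall x i j, Om x -> {for x, continuous (fun y => h y i j)}) ->
  [/\ C2_on Om u, forall x, Om x -> grad u x = g x
    & forall x, Om x -> hess u x = h x].
Proof.
move=> oOm cu du cg dg ch.
have near_Om y : Om y -> \forall z \near y, Om z by move=> Oy; exact: open_nbhs_nbhs.
have pE i x : Om x -> partial i u x = g x 0 i.
  by move=> /(du _ i)[_].
have near_p i x : Om x -> \forall y \near x, g y 0 i = partial i u y.
  by move=> Omx; apply: filterS (near_Om _ Omx) => y /pE->.
have dp x i j : Om x -> is_derive x (delta_mx 0 j) (partial i u) (h x i j).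
  move=> Omx; apply: is_derive_near_eq_dir (near_p i x Omx) _; last exact: dg.
  exact: delta_row_neq0.
have near_h i j x : Om x -> \forall y \near x, h y i j = partial j (partial i u) y.
  by move=> Omx; apply: filterS (near_Om _ Omx) => y /(dp _ i j)[_].
split.
- move=> x Omx; split; first exact: cu.
  + move=> i; split; first by case: (du x i Omx).
    by apply: near_eq_continuous (cg x i Omx); exact: near_p.
  + move=> i j; split; first by case: (dp x i j Omx).
    by apply: near_eq_continuous (ch x i j Omx); exact: near_h.
- by move=> x Omx; apply/rowP => i; rewrite mxE pE.
- by move=> x Omx; apply/matrixP => i j; rewrite mxE; case: (dp x i j Omx).
Qed.

(** On the segment from [x] to [y] the second derivative is the Hessian form in the direction y - x,
    and the one variable criterion applies. *)
Lemma convex_of_hess (R : realType) (n : nat) (Om : set 'rV[R]_n) (u : 'rV[R]_n -> R) :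
  open Om -> C2_on Om u ->
  (forall x y t, Om x -> Om y -> 0 <= t <= 1 -> Om (x + t *: (y - x))) ->
  (forall x v, Om x -> 0 <= quad (hess u x) v) -> convex_function Om u.
Proof.
move=> oOm u2 cOm H0 t x y /set_mem Omx /set_mem Omy.
pose v : 'rV[R]_n := (y : 'rV[R]_n) - x; pose f (s : R) : R^o := u (x + s *: v).
have Oms (s : R) : 0 <= s <= 1 -> Om (x + s *: v) by exact: cOm.
have df (s : R) : 0 <= s <= 1 -> is_derive s 1 f (dot v (grad u (x + s *: v))).
  by move=> /Oms; exact: is_derive_line_C2.
have near_df (s : R) : 0 < s < 1 ->
    \forall r \near s, dot v (grad u (x + r *: v)) = 'D_1 f r.
  move=> /andP[s0 s1]; near=> r; have [|_ ->//] := df r.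
  by apply/andP; split; apply/ltW; near: r; [exact: lt_nbhsr|exact: lt_nbhsl].
have ltW01 (s : R) : 0 < s < 1 -> 0 <= s <= 1 by move=> /andP[s0 s1]; rewrite !ltW.
have d2f (s : R) : 0 < s < 1 -> is_derive s 1 ('D_1 f) (quad (hess u (x + s *: v)) v).
  move=> s01; apply: is_derive_near_eq (near_df s s01) _.
  exact: (is_derive2_line_C2 oOm u2 (Oms _ (ltW01 _ s01))).
have cf (s : R) : 0 <= s <= 1 -> {for s, continuous f}.
  by move=> s01; exact: is_derive_continuous (df s s01).
have itvE (s : R) : s \in `]0, 1[ -> 0 < s < 1 by rewrite in_itv.
have H : f (conv t (0 : R^o) (1 : R^o)) <= conv t (f 0) (f 1).
  apply: (@second_derivative_convex R f 0 1) => //.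
  - by move=> s s01; have [_ ->] := d2f s s01; apply/H0/Oms/ltW01.
  - by apply/cvg_at_left_filter/cf; rewrite ler01 lexx.
  - by apply/cvg_at_right_filter/cf; rewrite ler01 lexx.
  - by move=> s /itvE/ltW01/df[].
  - by move=> s /itvE/d2f[].
(* Here [conv t x y] is t x + (1 - t) y, so [conv t 0 1] is 1 - t, the parameter of that point
   counted from [x]. *)
have fE : f (conv t (0 : R^o) (1 : R^o)) = u (conv t x y).
  rewrite convRE mulr0 add0r mulr1 /f; congr u.
  rewrite -[conv t x y]/(t%:num *: (x : 'rV[R]_n) + unstable.onem t%:num *: (y : 'rV[R]_n)).
  by rewrite /unstable.onem /v scalerBr !scalerBl !scale1r; apply/rowP => i; rewrite !mxE; ring.
move: H; rewrite fE /f scale0r addr0 scale1r /v.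
by rewrite [x + _]addrC subrK.
Unshelve. all: by end_near. Qed.

(** * Algebra of rank one Hessians *)

Lemma dotC (R : realType) (n : nat) (x y : 'rV[R]_n) : dot x y = dot y x.
Proof. by apply: eq_bigr => i _; rewrite mulrC. Qed.

Lemma dotDl (R : realType) (n : nat) (x y z : 'rV[R]_n) :
  dot (x + y) z = dot x z + dot y z.
Proof. by rewrite /dot -big_split; apply: eq_bigr => i _; rewrite mxE mulrDl. Qed.

Lemma dotZl (R : realType) (n : nat) (k : R) (x z : 'rV[R]_n) :
  dot (k *: x) z = k * dot x z.
Proof. by rewrite /dot mulr_sumr; apply: eq_bigr => i _; rewrite mxE mulrA. Qed.

(** Both Hessians below are combinations of such matrices, on which [mc_op] and [quad] reduce to
    inner products. *)
Definition rank1 (R : realType) (n : nat) (v : 'rV[R]_n) : 'M[R]_n := v^T *m v.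

Lemma rank1E (R : realType) (n : nat) (v : 'rV[R]_n) (i j : 'I_n) :
  rank1 v i j = v 0 i * v 0 j.
Proof. by rewrite /rank1 mxE big_ord1 mxE. Qed.

Lemma mc_opD (R : realType) (n : nat) (c : R) (p : 'rV[R]_n) (H K : 'M[R]_n) :
  mc_op c p (H + K) = mc_op c p H + mc_op c p K.
Proof.
rewrite /mc_op -big_split; apply: eq_bigr => i _; rewrite -big_split.
by apply: eq_bigr => j _; rewrite !mxE mulrDr.
Qed.

Lemma mc_opZ_rank1 (R : realType) (n : nat) (c k : R) (p v : 'rV[R]_n) :
  mc_op c p (k *: rank1 v) = k * (dot v v - dot p v ^+ 2 / c).
Proof.
rewrite /mc_op.
transitivity (\sum_i (k * (v 0 i * v 0 i) - k * (p 0 i * v 0 i) * dot p v / c)).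
  apply: eq_bigr => i _.
  transitivity (\sum_j ((i == j)%:R * (k * (v 0 i * v 0 j)) -
      k * (p 0 i * v 0 i) / c * (p 0 j * v 0 j))).
    by apply: eq_bigr => j _; rewrite mxE rank1E; ring.
  rewrite sumrB -mulr_sumr (bigD1 i)//= eqxx mul1r big1 ?addr0; last first.
    by move=> j /negbTE ji; rewrite eq_sym ji mul0r.
  by rewrite /dot; ring.
rewrite sumrB -mulr_sumr -!mulr_suml -mulr_sumr -/(dot v v) -/(dot p v).
by ring.
Qed.

Lemma quadD (R : realType) (n : nat) (H K : 'M[R]_n) (v : 'rV[R]_n) :
  quad (H + K) v = quad H v + quad K v.
Proof.
rewrite /quad -big_split; apply: eq_bigr => i _; rewrite -big_split.
by apply: eq_bigr => j _; rewrite !mxE mulrDr.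
Qed.

Lemma quadZ_rank1 (R : realType) (n : nat) (k : R) (v w : 'rV[R]_n) :
  quad (k *: rank1 v) w = k * dot w v ^+ 2.
Proof.
rewrite expr2 /dot /quad mulr_suml mulr_sumr; apply: eq_bigr => i _.
rewrite mulr_sumr mulr_sumr; apply: eq_bigr => j _.
by rewrite mxE rank1E; ring.
Qed.

(* On a line the squared radius is a polynomial of degree at most 2, hence
   constant or symmetric about its vertex, but [u] is injective there. *)
Lemma line_not_rotational (R : realType) (n k : nat) (Om : set 'rV[R]_n)
    (u : 'rV[R]_n -> R) (x v : 'rV[R]_n) :
  (forall t : R, Om (x + t *: v)) -> (forall t : R, u (x + t *: v) = u x + t) ->
  ~ k_rotationally_symmetric k Om u.
Proof.
move=> Omt ut [Q [c [phi [_ uphi]]]].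
pose P (i : 'I_n) := (i < k)%N.
pose a i := (x *m Q + c) 0 i; pose b i := (v *m Q) 0 i.
pose r t := \sum_(i | P i) (a i + t * b i) ^+ 2.
have inj s t : r s = r t -> s = t.
  have rE q : u x + q = phi (Num.sqrt (r q)).
    rewrite -ut uphi; last exact: Omt.
    congr (phi (Num.sqrt _)); apply: eq_bigr => i _; congr (_ ^+ 2).
    by rewrite /a /b mulmxDl -scalemxAl !mxE; ring.
  by move=> rst; apply: (@addrI _ (u x)); rewrite !rE rst.
pose A := \sum_(i | P i) b i ^+ 2; pose B := \sum_(i | P i) 2 * a i * b i.
have rE t : r t = r 0 + B * t + A * t ^+ 2.
  rewrite /r /A /B !mulr_suml -!big_split/=; apply: eq_bigr => i _; ring.
have [A0|A0] := eqVneq A 0.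
  have b0 i : P i -> b i = 0.
    move=> Pi; apply/eqP; rewrite -sqrf_eq0; move/eqP: A0.
    rewrite psumr_eq0; last by move=> j _; exact: sqr_ge0.
    by move=> /allP/(_ i (mem_index_enum _)); rewrite Pi.
  have := inj 0 1; rewrite [r 1]rE A0.
  rewrite /B big1; last by move=> i /b0->; rewrite mulr0.
  rewrite !mul0r !addr0 => /(_ erefl)/eqP.
  by rewrite eq_sym oner_eq0.
(* Two parameters at distance 1 on either side of the vertex -B / (2 A). *)
have := inj (1 - B / (2 * A)) (- 1 - B / (2 * A)).
rewrite rE [in RHS]rE => H; have : (1 : R) = -1.
  apply: (@addIr _ (- (B / (2 * A)))); apply: H; field.
  by rewrite A0.
lra.
Qed.

Lemma solution_of_classical (R : realType) (n : nat) (sigma : R) (Om : set 'rV[R]_n)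
    (u : 'rV[R]_n -> R) :
  open Om -> classical_solution sigma Om u -> (forall x, Om x -> grad u x != 0) ->
  solution sigma Om u.
Proof.
move=> oOm cu gu0; split=> // s0; apply: classical_viscosity => //.
by rewrite -s0.
Qed.

(** * The tilted bowl *)

Section Bowl.
Variables (R : realType) (n : nat) (a b d : 'I_n) (c : R) (G p dp : R -> R).
Hypotheses (ab : a != b) (ad : a != d) (bd : b != d) (c0 : 0 < c).
Hypotheses (dG : forall s : R, 0 <= s -> is_derive s 1 G (p s))
  (dpE : forall s : R, is_derive s 1 p (dp s)) (cdp : continuous dp)
  (p01 : forall s : R, 0 <= s -> 0 <= p s <= 1 / 2)
  (ode : forall s : R, 0 <= s ->
     4 * s * dp s = (1 - 2 * p s) * (1 + 4 * s * p s ^+ 2) - 2 * p s).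

(** The profile is composed with the squared radius, which is smooth across the axis, unlike the
    radius. *)
Let S (x : 'rV[R]_n) : R := c^-1 * (x 0 a * x 0 a + x 0 b * x 0 b).
Let X (x : 'rV[R]_n) : 'rV[R]_n := x 0 a *: delta_mx 0 a + x 0 b *: delta_mx 0 b.

Definition tilted_bowl (x : 'rV[R]_n) : R := c * G (S x) + x 0 d.
Let g (x : 'rV[R]_n) : 'rV[R]_n := (2 * p (S x)) *: X x + delta_mx 0 d.
Let h (x : 'rV[R]_n) : 'M[R]_n := (2 * p (S x)) *: rank1 (delta_mx 0 a) +
  (2 * p (S x)) *: rank1 (delta_mx 0 b) + (4 / c * dp (S x)) *: rank1 (X x).

Let S_ge0 x : 0 <= S x.
Proof. by rewrite mulr_ge0 ?invr_ge0 ?(ltW c0)// addr_ge0// -expr2 sqr_ge0. Qed.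

Let is_derive_S (x v : 'rV[R]_n) : is_derive x v S (2 / c * dot (X x) v).
Proof.
have da := is_derive_coord a x v; have db := is_derive_coord b x v.
have H := is_derive_scale (is_derive_add (is_derive_mul da da) (is_derive_mul db db)) c^-1.
apply: (is_derive_eq H); rewrite /X dotDl !dotZl !dot_delta.
by ring.
Qed.

Let coordE (k l : 'I_n) : (delta_mx 0 k : 'rV[R]_n) 0 l = (l == k)%:R.
Proof. by rewrite mxE eqxx. Qed.

Let X_coord (x : 'rV[R]_n) i : X x 0 i = x 0 a * (i == a)%:R + x 0 b * (i == b)%:R.
Proof. by rewrite !mxE !eqxx. Qed.

Let is_derive_u (x : 'rV[R]_n) i : is_derive x (delta_mx 0 i) tilted_bowl (g x 0 i).
Proof.
have dS := is_derive_S x (delta_mx 0 i).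
have dGS := is_derive_comp_real (dG (S_ge0 x)) dS.
have dd := is_derive_coord d x (delta_mx 0 i).
have H := is_derive_add (is_derive_scale dGS c) dd.
apply: (is_derive_eq H); rewrite dotC dot_delta coordE.
rewrite [RHS]mxE [X in _ = X + _]mxE coordE [d == i]eq_sym; field.
by rewrite gt_eqF.
Qed.

Let is_derive_X (x v : 'rV[R]_n) i : is_derive x v (fun y => X y 0 i) (X v 0 i).
Proof.
have da := is_derive_coord a x v; have db := is_derive_coord b x v.
have H := is_derive_add (is_derive_scale da (i == a)%:R) (is_derive_scale db (i == b)%:R).
have -> : (fun y : 'rV[R]_n => X y 0 i) =
    (fun y : 'rV[R]_n => (i == a)%:R * y 0 a + (i == b)%:R * y 0 b).
  by apply/funext => y; rewrite X_coord; ring.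
by apply: (is_derive_eq H); rewrite X_coord; ring.
Qed.

Let is_derive_g (x : 'rV[R]_n) i j :
  is_derive x (delta_mx 0 j) (fun y => g y 0 i) (h x i j).
Proof.
have dS := is_derive_S x (delta_mx 0 j).
have dpS := is_derive_scale (is_derive_comp_real (dpE (S x)) dS) 2.
have dX := is_derive_X x (delta_mx 0 j) i.
have H := is_derive_add (is_derive_mul dpS dX) (is_derive_cst ((i == d)%:R : R) x (delta_mx 0 j)).
have -> : (fun y : 'rV[R]_n => g y 0 i) = (fun y => 2 * (p \o S) y * X y 0 i + cst (i == d)%:R y).
  by apply/funext => y; rewrite mxE [X in X + _]mxE coordE.
apply: (is_derive_eq H); rewrite dotC dot_delta.
rewrite [RHS]mxE [X in _ = X + _]mxE ![X in _ = X + _ + _]mxE ![X in _ = _ + X + _]mxE.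
rewrite [X in _ = _ + X]mxE !rank1E !X_coord !coordE.
have -> : (p \o S) x = p (S x) by [].
rewrite [a == j]eq_sym [b == j]eq_sym; field.
by rewrite gt_eqF.
Qed.

Let cont_coord (i : 'I_n) (x : 'rV[R]_n) : {for x, continuous (fun y : 'rV[R]_n => y 0 i)}.
Proof. exact: coord_continuous. Qed.

Let cont_S (x : 'rV[R]_n) : {for x, continuous S}.
Proof.
have ca := @cont_coord a x; have cb := @cont_coord b x.
exact: (continuous_scale (continuous_add (continuous_mul ca ca) (continuous_mul cb cb)) c^-1).
Qed.

Let cont_pS (x : 'rV[R]_n) : {for x, continuous (fun x : 'rV[R]_n => p (S x))}.
Proof. exact: (continuous_comp_real (cont_S (x:=x)) (is_derive_continuous (dpE _))). Qed.

Let cont_X i (x : 'rV[R]_n) : {for x, continuous (fun x : 'rV[R]_n => X x 0 i)}.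
Proof.
have H := continuous_add (continuous_scale (@cont_coord a x) (i == a)%:R)
  (continuous_scale (@cont_coord b x) (i == b)%:R).
have -> : (fun y : 'rV[R]_n => X y 0 i) =
    (fun y : 'rV[R]_n => (i == a)%:R * y 0 a + (i == b)%:R * y 0 b).
  by apply/funext => y; rewrite X_coord; ring.
exact: H.
Qed.

Let cont_cst (k : R) (x : 'rV[R]_n) : {for x, continuous (fun _ : 'rV[R]_n => k)}.
Proof. exact: cst_continuous. Qed.

Let C2 : [/\ C2_on setT tilted_bowl, forall x, setT x -> grad tilted_bowl x = g x
    & forall x, setT x -> hess tilted_bowl x = h x].
Proof.
apply: C2_intro => //.
- exact: openT.
- move=> x _; have cG := is_derive_continuous (dG (S_ge0 x)).
  exact: (continuous_add (continuous_scale (continuous_comp_real (cont_S (x:=x)) cG) c)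
    (@cont_coord d x)).
- move=> x i _.
  have -> : (fun y : 'rV[R]_n => g y 0 i) = (fun y => 2 * p (S y) * X y 0 i + (i == d)%:R).
    by apply/funext => y; rewrite mxE [X in X + _]mxE coordE.
  exact: (continuous_add (continuous_mul (continuous_scale (@cont_pS x) 2) (@cont_X i x))
    (@cont_cst _ x)).
- move=> x i j _.
  have -> : (fun y : 'rV[R]_n => h y i j) = (fun y => (rank1 (delta_mx 0 a) i j +
      rank1 (delta_mx 0 b) i j) * (2 * p (S y)) + 4 / c * dp (S y) * (X y 0 i * X y 0 j)).
    apply/funext => y; rewrite [LHS]mxE [in LHS]mxE.
    by rewrite ![X in X + _ + _]mxE ![X in _ + X + _]mxE ![X in _ + X = _]mxE !rank1E; ring.
  have cdpS := continuous_comp_real (cont_S (x:=x)) (@cdp (S x)).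
  exact: (continuous_add (continuous_scale (continuous_scale (@cont_pS x) 2) _)
    (continuous_mul (continuous_scale cdpS (4 / c))
      (continuous_mul (@cont_X i x) (@cont_X j x)))).
Qed.

Let dotX (x v : 'rV[R]_n) : dot (X x) v = x 0 a * v 0 a + x 0 b * v 0 b.
Proof. by rewrite /X dotDl !dotZl !dot_delta. Qed.

Let sS (x : 'rV[R]_n) : x 0 a ^+ 2 + x 0 b ^+ 2 = c * S x.
Proof. by rewrite /S; field; rewrite gt_eqF. Qed.

Let Xa x : X x 0 a = x 0 a. Proof. by rewrite X_coord eqxx (negbTE ab) /=; ring. Qed.
Let Xb x : X x 0 b = x 0 b.
Proof. by rewrite X_coord eqxx eq_sym (negbTE ab) /=; ring. Qed.
Let Xd x : X x 0 d = 0.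
Proof. by rewrite X_coord ![d == _]eq_sym (negbTE ad) (negbTE bd) /=; ring. Qed.
Let ga x : g x 0 a = 2 * p (S x) * x 0 a.
Proof. by rewrite mxE [X in X + _]mxE Xa coordE (negbTE ad) addr0. Qed.
Let gb x : g x 0 b = 2 * p (S x) * x 0 b.
Proof. by rewrite mxE [X in X + _]mxE Xb coordE (negbTE bd) addr0. Qed.
Let gd x : g x 0 d = 1.
Proof. by rewrite mxE [X in X + _]mxE Xd coordE eqxx /=; ring. Qed.

(** In the plane of the bowl the Hessian has the tangential eigenvalue 2 P and the radial eigenvalue
    2 P + 4 s D, with P and D the values of [p] and [dp] at s. The tilt adds 1 to |Du|^2, which
    makes sigma + |Du|^2 equal to c (1 + 4 s P^2). *)
Lemma tilted_bowl_solution (sigma : R) : c = sigma + 1 ->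
  entire_convex_solution sigma tilted_bowl.
Proof.
move=> cE; have [u2 gE hE] := C2.
split.
- apply: convex_of_hess => // [|x v _]; first exact: openT.
  rewrite hE// /h !quadD !quadZ_rank1 ![dot v _]dotC !dot_delta dotX.
  have /andP[p0 p2] := p01 (S_ge0 x); have := ode (S_ge0 x); have s0 := S_ge0 x.
  set s := S x in p0 p2 s0 *; set P := p s in p0 p2 *; set D := dp s => E.
  set va := v 0 a; set vb := v 0 b; set xa := x 0 a; set xb := x 0 b.
  have xs : xa ^+ 2 + xb ^+ 2 = c * s by rewrite /xa /xb sS.
  (* By the slope equation the radial eigenvalue is (1 - 2 P) (1 + 4 s P^2). *)
  have main : 0 <= 2 * P + 4 * s * D.
    by rewrite E addrC subrK mulr_ge0//; [lra|nra].
  have [D0|D0] := leP 0 D.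
    rewrite !addr_ge0// mulr_ge0 ?sqr_ge0//; first lra.
    - lra.
    - by rewrite mulr_ge0// divr_ge0// ltW.
  (* For D < 0, Lagrange's identity trades the square of the inner product for the square of the
     cross product, which then has a positive coefficient. *)
  have -> : 2 * P * va ^+ 2 + 2 * P * vb ^+ 2 +
      4 / c * D * (xa * va + xb * vb) ^+ 2 =
    (va ^+ 2 + vb ^+ 2) * (2 * P + 4 * s * D) + 4 / c * (- D) *
      (xa * vb - xb * va) ^+ 2.
    have -> : s = (xa ^+ 2 + xb ^+ 2) / c by rewrite xs; field; rewrite gt_eqF.
    by field; rewrite gt_eqF.
  apply: addr_ge0; apply: mulr_ge0 => //; rewrite ?addr_ge0 ?sqr_ge0//.
  by rewrite mulr_ge0 ?oppr_ge0 ?divr_ge0// ltW.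
- apply: solution_of_classical; first exact: openT.
    split=> // x _; rewrite hE// gE// sqr_enorm /h !mc_opD !mc_opZ_rank1.
    rewrite ![dot (g x) (delta_mx _ _)]dotC ![dot (g x) (X x)]dotC !dot_delta !dotX Xa Xb.
    rewrite !coordE !eqxx.
    have -> : dot (g x) (g x) = 4 * p (S x) ^+ 2 * (c * S x) + 1.
      by rewrite {1}/g dotDl dotZl dotX dot_delta ga gb gd -sS; ring.
    rewrite ga gb -!expr2.
    have E := ode (S_ge0 x); have s0 := S_ge0 x.
    have xs := sS x; have /andP[p0 p2] := p01 s0.
    set s := S x in E s0 xs p0 p2 *; set P := p s in E p0 p2 *; set D := dp s in E *.
    set xa := x 0 a in xs *; set xb := x 0 b in xs *.
    have -> : sigma + (4 * P ^+ 2 * (c * s) + 1) = c * (1 + 4 * s * P ^+ 2).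
      by rewrite cE; ring.
    set W := 1 + 4 * s * P ^+ 2 in E *.
    have W0 : W != 0 by rewrite gt_eqF// /W; nra.
    have c_neq0 : c != 0 by rewrite gt_eqF.
    have -> : xa * (2 * P * xa) + xb * (2 * P * xb) = 2 * P * (c * s) by rewrite -xs; ring.
    have -> : xa * xa + xb * xb = c * s by rewrite -xs; ring.
    have -> : 2 * P * (1 - (2 * P * xa) ^+ 2 / (c * W)) +
        2 * P * (1 - (2 * P * xb) ^+ 2 / (c * W)) =
        4 * P - 8 * P ^+ 3 * s / W.
      have -> : s = (xa ^+ 2 + xb ^+ 2) / c by rewrite xs; field.
      by field; rewrite W0 c_neq0.
    have -> : 4 / c * D * (c * s - (2 * P * (c * s)) ^+ 2 / (c * W)) =
       (4 * s * D) * (W - 4 * P ^+ 2 * s) / W by field; rewrite W0 c_neq0.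
    (* What remains is 4 P - 2 P (W - 1) / W + ((1 - 2 P) W - 2 P) / W = 1. *)
    rewrite E (_ : W - _ = 1); last by rewrite /W; ring.
    have -> : 8 * P ^+ 3 * s = 2 * P * (W - 1) by rewrite /W; ring.
    by field.
  move=> x _; rewrite gE//; apply/eqP => /rowP/(_ d).
  by rewrite gd mxE => /eqP; rewrite oner_eq0.
Qed.

Lemma tilted_bowl_not_rotational (k : nat) :
  ~ k_rotationally_symmetric k setT tilted_bowl.
Proof.
apply: (@line_not_rotational _ _ _ _ _ 0 (delta_mx 0 d)) => // t.
rewrite /tilted_bowl /S; set e := delta_mx 0 d.
have [ea eb ed] : [/\ e 0 a = 0, e 0 b = 0 & e 0 d = 1].
  by rewrite /e !coordE eqxx (negbTE ad) (negbTE bd).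
(* Making [e] opaque keeps [mxE] from unfolding its entries, so that [ea], [eb] and [ed] can rewrite
   them. *)
clearbody e; by rewrite !mxE ea eb ed !(mulr0, mulr1, addr0, add0r, mul0r).
Qed.

End Bowl.

(** * The tilted grim reaper *)

Lemma continuous_row (R : realType) (n : nat) (gamma : R -> 'rV[R]_n) (t : R) :
  (forall j, {for t, continuous (fun s => gamma s 0 j)}) -> {for t, continuous gamma}.
Proof.
move=> H A [P HP PA].
have : \forall s \near t, forall i j, P i j (gamma s i j).
  have H2 (i : 'I_1) j : \forall s \near t, P i j (gamma s i j).
    by move: (HP i j); rewrite ord1; exact: H.
  have H1 (i : 'I_1) := @filter_forall R 'I_n (fun j s => P i j (gamma s i j)) (nbhs t) (nbhs_filter t) (H2 i).
  exact: (@filter_forall R 'I_1 (fun i s => forall j, P i j (gamma s i j)) (nbhs t) (nbhs_filter t) H1).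
by apply: filterS => s Hs; apply: PA.
Qed.

(** * Euclidean norm, length of curves and intrinsic distance *)

Lemma normr_le_enorm (R : realType) (n : nat) (x : 'rV[R]_n) (j : 'I_n) : `|x 0 j| <= enorm x.
Proof.
rewrite -sqrtr_sqr ler_sqrt ?sumr_ge0// => [|i _]; last by rewrite -expr2 sqr_ge0.
by rewrite /dot (bigD1 j)//= -expr2 lerDl sumr_ge0// => i _; rewrite -expr2 sqr_ge0.
Qed.

Lemma enorm_le_sum (R : realType) (n : nat) (x : 'rV[R]_n) : enorm x <= \sum_j `|x 0 j|.
Proof.
have s0 : 0 <= \sum_j `|x 0 j| by exact: sumr_ge0.
rewrite -[leRHS]ger0_norm// -sqrtr_sqr ler_sqrt ?sqr_ge0// expr2 mulr_suml.
apply: ler_sum => i _.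
rewrite (_ : x 0 i * x 0 i = `|x 0 i| * `|x 0 i|); last first.
  by rewrite -normrM -expr2 ger0_norm ?sqr_ge0.
rewrite ler_wpM2l//.
by rewrite (bigD1 i)//= lerDl sumr_ge0.
Qed.

Lemma enorm_ge0 (R : realType) (n : nat) (x : 'rV[R]_n) : 0 <= enorm x.
Proof. exact: sqrtr_ge0. Qed.

(** The partition with the single point 1 contributes the chord. *)
Lemma curve_length_ge (R : realType) (m : nat) (gamma : R -> 'rV[R]_m) :
  ((enorm (gamma 1%R - gamma 0%R))%:E <= curve_length gamma)%E.
Proof.
apply: ereal_sup_ubound; exists [:: 1]; first exact: itv_partition1.
by rewrite /polygonal_length /= big_nat1.
Qed.

Lemma intrinsic_dist_ge0 (R : realType) (m : nat) (S : set 'rV[R]_m) (p q : 'rV[R]_m) :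
  (0 <= intrinsic_dist S p q)%E.
Proof.
apply: le_ereal_inf_tmp => _ [gamma _ <-].
by apply: le_trans (curve_length_ge gamma); rewrite lee_fin enorm_ge0.
Qed.

(** A curve is at least as long as its chord. Hence a Cauchy sequence for the intrinsic distance is
    Cauchy in each coordinate. *)
Lemma intrinsic_dist_lt_coord (R : realType) (m : nat) (S : set 'rV[R]_m)
    (p q : 'rV[R]_m) (e : R) (j : 'I_m) :
  (intrinsic_dist S p q < e%:E)%E -> `|q 0 j - p 0 j| < e.
Proof.
move=> /ereal_inf_lt[_ [gamma [_ _ g0 g1] <-]] le.
rewrite -lte_fin; apply: le_lt_trans le; apply: le_trans (curve_length_ge gamma).
rewrite lee_fin g0 g1; have := normr_le_enorm (q - p) j.
by rewrite !mxE.
Qed.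

(** The chord bounds telescope to L over any partition of [0, 1]. *)
Lemma curve_length_lipschitz (R : realType) (m : nat) (gamma : R -> 'rV[R]_m) (L : R) :
  (forall s t : R, 0 <= s -> s <= t -> t <= 1 ->
    enorm (gamma t - gamma s) <= (t - s) * L) ->
  (curve_length gamma <= L%:E)%E.
Proof.
move=> H; apply: ge_ereal_sup => _ [s ps <-]; rewrite lee_fin /polygonal_length /=.
have [pth lst] := ps.
pose F i := nth 1 (0 :: s) i.
apply: (@le_trans _ _ (\sum_(0 <= i < size s) (F i.+1 - F i) * L)).
  apply: ler_sum_nat => i /andP[_ is_]; apply: H.
  - by apply: (itv_partition_nth_ge _ ps); rewrite ltnS ltnW.
  - by apply/ltW; move/(pathP 1) : pth => /(_ i is_).
  - rewrite -[nth 1 s i]/(nth 1 (0 :: s) i.+1).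
    by apply: (itv_partition_nth_le _ ps); rewrite ltnS.
rewrite -mulr_suml telescope_sumr// {1}/F {1}/F /=.
have -> : nth 1 (0 :: s) (size s) = 1 by rewrite nth_last /= (eqP lst).
by rewrite subr0 mul1r.
Qed.

Lemma cvgn_of_cauchy (R : realType) (a : nat -> R) :
  (forall e, 0 < e -> exists N, forall i j, (N <= i)%N -> (N <= j)%N -> `|a j - a i| < e) ->
  cvgn a.
Proof.
move=> H; apply: R_complete; apply: cauchy_exP => e e0.
have [N HN] := H e e0; exists (a N); exists N => // i /= Ni.
by rewrite /ball/= distrC; apply: HN.
Qed.

Lemma segment_itv (R : realType) (c d x y t : R) :
  c < x < d -> c < y < d -> 0 <= t <= 1 -> c < x + t * (y - x) < d.
Proof.
move=> /andP[cx xd] /andP[cy yd] /andP[t0 t1].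
have [xy|yx] := leP x y.
  have h1 : 0 <= t * (y - x) by rewrite mulr_ge0// subr_ge0.
  have h2 : 0 <= (1 - t) * (y - x) by rewrite mulr_ge0// subr_ge0.
  by apply/andP; split; lra.
have h1 : 0 <= t * (x - y) by rewrite mulr_ge0// subr_ge0 ltW.
have h2 : 0 <= (1 - t) * (x - y) by rewrite mulr_ge0// subr_ge0// ltW.
by apply/andP; split; lra.
Qed.

(** * The solution over the strip and its completeness *)

Section GrimReaper.
Variables (R : realType) (n : nat) (a b : 'I_n) (k : R).
Hypotheses (ab : a != b) (k0 : 0 < k).

(** The half width of the strip. In the application k is the square root of sigma + 1; the cosine
    below vanishes on the two boundary hyperplanes. *)
Let w : R := k * (pi / 2).
Definition reaper_strip : set 'rV[R]_n := [set x | - w < dot (delta_mx 0 a) x < w].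

Let f (y : R) : R := - (k ^+ 2) * ln (cos (k^-1 * y)).
Definition tilted_reaper (x : 'rV[R]_n) : R := f (x 0 a) + x 0 b.

Let g (x : 'rV[R]_n) : 'rV[R]_n :=
  (k * tan (k^-1 * x 0 a)) *: delta_mx 0 a + delta_mx 0 b.
Let h (x : 'rV[R]_n) : 'M[R]_n := (cos (k^-1 * x 0 a) ^- 2) *: rank1 (delta_mx 0 a).

Let coordE (i j : 'I_n) : (delta_mx 0 i : 'rV[R]_n) 0 j = (j == i)%:R.
Proof. by rewrite mxE eqxx. Qed.

Let stripE (x : 'rV[R]_n) : reaper_strip x = (- w < x 0 a < w) :> Prop.
Proof. by rewrite /reaper_strip /= dot_delta. Qed.

Let w0 : 0 < w. Proof. by rewrite mulr_gt0// divr_gt0// pi_gt0. Qed.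

Let cos_gt0 (y : R) : - w < y < w -> 0 < cos (k^-1 * y).
Proof.
move=> /andP[wy yw]; apply: cos_gt0_pihalf; apply/andP; split.
  by rewrite ltr_pdivlMl// mulrN.
by rewrite ltr_pdivrMl.
Qed.

Let is_derive_scaled (F : R -> R) (dF y : R) : is_derive (k^-1 * y) 1 F dF ->
  is_derive y 1 (fun z => F (k^-1 * z)) (dF * k^-1).
Proof.
move=> d; have di := is_derive_scale (is_derive_id y (1 : R)) k^-1.
by have := is_derive1_comp d di; rewrite mulr1.
Qed.

Let is_derive_f (y : R) : - w < y < w -> is_derive y 1 f (k * tan (k^-1 * y)).
Proof.
move=> /cos_gt0 c0.
have d1 := is_derive1_comp (is_derive1_ln c0) (is_derive_scaled (is_derive_cos (k^-1 * y))).
apply: (is_derive_eq (is_derive_scale d1 (- (k ^+ 2)))).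
rewrite /tan; field.
by rewrite !gt_eqF.
Qed.

Let is_derive_df (y : R) : - w < y < w ->
  is_derive y 1 (fun z => k * tan (k^-1 * z)) (cos (k^-1 * y) ^- 2).
Proof.
move=> /cos_gt0 c0; have cn0 : cos (k^-1 * y) != 0 by rewrite gt_eqF.
have d1 := is_derive_scaled (is_derive_tan cn0).
apply: (is_derive_eq (is_derive_scale d1 k)); field.
by rewrite cn0 gt_eqF.
Qed.

Let cont_coord (i : 'I_n) (x : 'rV[R]_n) : {for x, continuous (fun y : 'rV[R]_n => y 0 i)}.
Proof. exact: coord_continuous. Qed.

Lemma open_reaper_strip : open reaper_strip.
Proof.
have -> : reaper_strip = (fun x : 'rV[R]_n => x 0 a) @^-1` `]-w, w[.
  by apply/funext => x; rewrite stripE /= in_itv.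
by apply: open_comp; [move=> x _; exact: cont_coord|exact: interval_open].
Qed.

Let C2 : [/\ C2_on reaper_strip tilted_reaper,
    forall x, reaper_strip x -> grad tilted_reaper x = g x
    & forall x, reaper_strip x -> hess tilted_reaper x = h x].
Proof.
have gE i : (fun y : 'rV[R]_n => g y 0 i) =
    (fun y => (i == a)%:R * (k * tan (k^-1 * y 0 a)) + (i == b)%:R).
  by apply/funext => y; rewrite mxE [X in X + _]mxE !coordE mulrC.
have hE i j : (fun y : 'rV[R]_n => h y i j) =
    (fun y => rank1 (delta_mx 0 a) i j * (cos (k^-1 * y 0 a) ^- 2)).
  by apply/funext => y; rewrite mxE mulrC.
apply: C2_intro; first exact: open_reaper_strip.
- move=> x; rewrite stripE => xw.
  exact: (continuous_add (continuous_comp_real (@cont_coord a x)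
    (is_derive_continuous (is_derive_f xw))) (@cont_coord b x)).
- move=> x i; rewrite stripE => xw.
  have H := is_derive_add (is_derive_comp_real (is_derive_f xw)
    (is_derive_coord a x (delta_mx 0 i))) (is_derive_coord b x (delta_mx 0 i)).
  apply: (is_derive_eq H); rewrite !coordE.
  by rewrite [RHS](congr1 (fun F => F x) (gE i)) [a == i]eq_sym [b == i]eq_sym mulrC.
- move=> x i; rewrite stripE => xw; rewrite gE.
  apply: continuous_add; last exact: cst_continuous.
  apply: continuous_scale.
  exact: (continuous_comp_real (@cont_coord a x) (is_derive_continuous (is_derive_df xw))).
- move=> x i j; rewrite stripE => xw; rewrite gE.
  have H := is_derive_add (is_derive_scale (is_derive_comp_real (is_derive_df xw)
    (is_derive_coord a x (delta_mx 0 j))) (i == a)%:R)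
    (is_derive_cst ((i == b)%:R : R) x (delta_mx 0 j)).
  apply: (is_derive_eq H); rewrite coordE addr0.
  rewrite [RHS](congr1 (fun F => F x) (hE i j)) rank1E !coordE [a == j]eq_sym; ring.
- move=> x i j; rewrite stripE => xw; rewrite hE; apply: continuous_scale.
  have cx := @cos_gt0 _ xw.
  have c1 : {for x 0 a, continuous (fun y => cos (k^-1 * y) ^- 2)}.
    apply: cvgV; first by rewrite sqrf_eq0 gt_eqF.
    have cc := is_derive_continuous (is_derive_scaled (is_derive_cos (k^-1 * x 0 a))).
    exact: (continuous_mul cc cc).
  exact: (continuous_comp_real (@cont_coord a x) c1).
Qed.

(** With T the tangent, the second derivative of the profile is 1 + T^2, and the tilt makes sigma +
    |Du|^2 equal to k^2 (1 + T^2); the operator is (1 + T^2) (1 - T^2 / (1 + T^2)) = 1. *)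
Lemma tilted_reaper_solution (sigma : R) : k ^+ 2 = sigma + 1 ->
  convex_solution sigma reaper_strip tilted_reaper.
Proof.
move=> kE; have [u2 gE hE] := C2; split.
- apply: convex_of_hess u2 _ _; first exact: open_reaper_strip.
    move=> x y t; rewrite !stripE => /andP[x1 x2] /andP[y1 y2] /andP[t0 t1].
    by rewrite !mxE; apply: segment_itv; rewrite ?x1 ?y1 ?t0.
  move=> x v xw; rewrite hE// quadZ_rank1; apply: mulr_ge0; last exact: sqr_ge0.
  by rewrite invr_ge0 sqr_ge0.
- apply: solution_of_classical; first exact: open_reaper_strip.
    split=> // x xw; rewrite gE// hE// sqr_enorm mc_opZ_rank1.
    have cn0 : cos (k^-1 * x 0 a) != 0.
      by rewrite gt_eqF// cos_gt0// -stripE.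
    have e : dot (g x) (delta_mx 0 a) = k * tan (k^-1 * x 0 a).
      by rewrite dotC dot_delta mxE [X in X + _]mxE !coordE eqxx (negbTE ab) addr0 mulr1.
    have -> : dot (g x) (g x) = (k * tan (k^-1 * x 0 a)) ^+ 2 + 1.
      rewrite {2}/g dotC dotDl dotZl ![dot (delta_mx _ _) _]dotC e dotC dot_delta.
      have -> : g x 0 b = 1.
        by rewrite mxE [X in X + _]mxE !coordE eqxx eq_sym (negbTE ab) mulr0 add0r.
      by ring.
    rewrite e dot_delta coordE eqxx cos2_tan2//.
    set T := tan _.
    have -> : sigma + ((k * T) ^+ 2 + 1) = k ^+ 2 * (1 + T ^+ 2).
      by rewrite exprMn kE; ring.
    have T0 : 1 + T ^+ 2 != 0 by rewrite gt_eqF// ltr_pwDl// sqr_ge0.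
    by rewrite /=; field; rewrite T0 gt_eqF.
  move=> x xw; rewrite gE//; apply/eqP => /rowP/(_ b).
  rewrite mxE [X in X + _]mxE !coordE eqxx eq_sym (negbTE ab) mulr0 add0r mxE => /eqP.
  by rewrite oner_eq0.
Qed.

Lemma tilted_reaper_not_rotational (m : nat) :
  ~ k_rotationally_symmetric m reaper_strip tilted_reaper.
Proof.
have ea : (delta_mx 0 b : 'rV[R]_n) 0 a = 0 by rewrite coordE (negbTE ab).
have eb : (delta_mx 0 b : 'rV[R]_n) 0 b = 1 by rewrite coordE eqxx.
set e := delta_mx 0 b in ea eb; clearbody e.
apply: (@line_not_rotational _ _ _ _ _ 0 e) => t.
  by rewrite stripE !mxE ea mulr0 addr0 oppr_lt0 w0.
by rewrite /tilted_reaper !mxE ea eb mulr0 mulr1 addr0 add0r addr0.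
Qed.

(** The sine is at most 1 in absolute value, and the cosine decreases with the absolute value of its
    argument on [-pi, pi]. *)
Let df_bound (y r : R) : `|y| <= r -> r < w ->
  `|k * tan (k^-1 * y)| <= k / cos (k^-1 * r).
Proof.
move=> yr rw; have r0 : 0 <= r by exact: le_trans yr.
have yw : - w < y < w by rewrite -ltr_norml (le_lt_trans yr).
have rww : - w < r < w by rewrite rw andbT (lt_le_trans _ r0)// oppr_lt0.
have cy := cos_gt0 yw; have cr := cos_gt0 rww.
have kpi (z : R) : z < w -> k^-1 * z <= pi.
  move=> zw; apply: (@le_trans _ _ (pi / 2)); first by rewrite ler_pdivrMl// ltW.
  by rewrite ler_pdivrMr// ler_pMr ?pi_gt0// ler1n.
have cle : cos (k^-1 * r) <= cos (k^-1 * y).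
  rewrite -[cos (k^-1 * y)]cos_norm normrM gtr0_norm ?invr_gt0//.
  move: (yr); rewrite le_eqVlt => /predU1P[->//|yr'].
  apply/ltW; rewrite ltr_cos ?ltr_pM2l ?invr_gt0// in_itv/=.
    by rewrite mulr_ge0 ?invr_ge0 ?(ltW k0)//= kpi// (le_lt_trans yr).
  by rewrite mulr_ge0 ?invr_ge0 ?(ltW k0)//= kpi.
rewrite normrM gtr0_norm// ler_pM2l// /tan normrM normfV (gtr0_norm cy).
apply: (@le_trans _ _ (1 / cos (k^-1 * y))).
  by rewrite ler_pM2r ?invr_gt0// ler_norml sin_geN1 sin_le1.
by rewrite div1r lef_pV2.
Qed.

Let graph_point (x : 'rV[R]_n) : 'rV[R]_(n + 1) := row_mx x (tilted_reaper x)%:M.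

Let graph_pointl x j : graph_point x 0 (lshift 1 j) = x 0 j.
Proof. exact: row_mxEl. Qed.

Let graph_pointr x j : graph_point x 0 (rshift n j) = tilted_reaper x.
Proof. by rewrite /graph_point row_mxEr ord1 mxE eqxx mulr1n. Qed.

(** The straight segment is lifted to the graph. It stays in the closed substrip of half width r,
    where the profile has slope at most k / cos (r / k); the 2 accounts for the horizontal motion
    and the tilt. *)
Let intrinsic_segment (x y : 'rV[R]_n) (r : R) : r < w -> `|x 0 a| <= r -> `|y 0 a| <= r ->
  (intrinsic_dist (graph reaper_strip tilted_reaper) (graph_point x) (graph_point y) <=
   ((2 + k / cos (k^-1 * r)) * \sum_j `|y 0 j - x 0 j|)%:E)%E.
Proof.
move=> rw xr yr; pose z (t : R) := x + t *: (y - x); pose T := k / cos (k^-1 * r).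
have zE t j : z t 0 j = x 0 j + t * (y 0 j - x 0 j) by rewrite !mxE.
have zr t : 0 <= t <= 1 -> `|z t 0 a| <= r.
  move=> /andP[t0 t1]; rewrite zE.
  have -> : x 0 a + t * (y 0 a - x 0 a) = (1 - t) * x 0 a + t * y 0 a by ring.
  apply: le_trans (ler_normD _ _) _; rewrite !normrM (ger0_norm t0).
  have t1' : 0 <= 1 - t by rewrite subr_ge0.
  have e1 : (1 - t) * `|x 0 a| <= (1 - t) * r by rewrite ler_wpM2l.
  have e2 : t * `|y 0 a| <= t * r by rewrite ler_wpM2l.
  by rewrite (ger0_norm t1'); lra.
have zw t : 0 <= t <= 1 -> - w < z t 0 a < w.
  by move=> /zr zt; rewrite -ltr_norml (le_lt_trans zt).
have zOm t : 0 <= t <= 1 -> reaper_strip (z t) by move=> /zw zt; rewrite stripE.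
pose gamma t := graph_point (z t).
have dz (t : R) j : is_derive t 1 (fun s => z s 0 j) (y 0 j - x 0 j).
  have -> : (fun s => z s 0 j) = (fun s => (x + s *: (y - x)) 0 j) by [].
  apply/(is_derive_line (fun v : 'rV[R]_n => v 0 j)).
  by apply: (is_derive_eq (is_derive_coord j _ _)); rewrite !mxE.
have T0 : 0 <= T.
  have r0 : 0 <= r by exact: le_trans xr.
  rewrite divr_ge0 ?(ltW k0)// ltW// cos_gt0// rw andbT.
  by rewrite (lt_le_trans _ r0)// oppr_lt0.
apply: (@le_trans _ _ (curve_length gamma)).
  apply: ereal_inf_lbound; exists gamma => //; split.
  - apply: continuous_in_subspaceT => t; rewrite inE/= in_itv/= => t01.
    apply: continuous_row => j; case: (split_ordP j) => i ->.
      rewrite (_ : (fun s => gamma s 0 _) = (fun s => z s 0 i)); last first.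
        by apply/funext => s; exact: graph_pointl.
      exact: is_derive_continuous (dz t i).
    rewrite (_ : (fun s => gamma s 0 _) = (fun s => f (z s 0 a) + z s 0 b)); last first.
      by apply/funext => s; exact: graph_pointr.
    apply: continuous_add; last exact: is_derive_continuous (dz t b).
    apply: (continuous_comp_real (is_derive_continuous (dz t a))).
    exact: is_derive_continuous (is_derive_f (zw t t01)).
  - by move=> t; rewrite in_itv/= => t01; exists (z t) => //; exact: zOm.
  - by rewrite /gamma /z scale0r addr0.
  - by rewrite /gamma /z scale1r addrC subrK.
apply: curve_length_lipschitz => s t s0 st t1.
apply: le_trans (enorm_le_sum _) _; rewrite big_split_ord/= big_ord1.
pose M := \sum_j `|y 0 j - x 0 j|.
have ts0 : 0 <= t - s by rewrite subr_ge0.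
have subE l : (gamma t - gamma s) 0 l = graph_point (z t) 0 l - graph_point (z s) 0 l.
  by rewrite mxE [X in _ + X]mxE.
have zd j : z t 0 j - z s 0 j = (t - s) * (y 0 j - x 0 j) by rewrite !zE; ring.
have -> : \sum_(i < n) `|(gamma t - gamma s) 0 (lshift 1 i)| = (t - s) * M.
  rewrite mulr_sumr; apply: eq_bigr => j _.
  by rewrite subE !graph_pointl zd normrM ger0_norm.
have leM j : `|y 0 j - x 0 j| <= M.
  by rewrite /M (bigD1 j)//= lerDl sumr_ge0.
rewrite subE !graph_pointr /tilted_reaper.
have -> : f (z t 0 a) + z t 0 b - (f (z s 0 a) + z s 0 b) =
    (f (z t 0 a) - f (z s 0 a)) + (z t 0 b - z s 0 b) by ring.
have dfz (q : R) : 0 <= q <= 1 ->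
    is_derive q 1 (fun q => f (z q 0 a)) (k * tan (k^-1 * z q 0 a) * (y 0 a - x 0 a)).
  by move=> q01; exact: (is_derive1_comp (is_derive_f (zw q q01)) (dz q a)).
have st01 (q : R) : s <= q <= t -> 0 <= q <= 1.
  by move=> /andP[sq qt]; rewrite (le_trans s0 sq) (le_trans qt t1).
have [||q] := @MVT_segment R (fun q => f (z q 0 a))
    (fun q => k * tan (k^-1 * z q 0 a) * (y 0 a - x 0 a)) s t st.
- by move=> q; rewrite in_itv/= => /andP[sq qt]; apply/dfz/st01; rewrite !ltW.
- apply: derivable_within_continuous => q; rewrite in_itv/= => sqt.
  by case: (dfz q (st01 q sqt)).
rewrite in_itv/= => sqt ->; rewrite zd.
(* The three terms bound the horizontal displacement, the rise of the profile and the rise of the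
   tilt. *)
apply: (@le_trans _ _ ((t - s) * M + ((t - s) * (T * M) + (t - s) * M))).
  rewrite lerD2l; apply: le_trans (ler_normD _ _) _; apply: lerD.
    rewrite normrM (ger0_norm ts0) mulrC ler_wpM2l// normrM ler_pM//.
    exact: df_bound (zr q (st01 q sqt)) rw.
  by rewrite normrM (ger0_norm ts0) ler_wpM2l.
by rewrite -/T -/M; lra.
Qed.

(** The coordinates of a Cauchy sequence converge, heights included. As the profile blows up at the
    boundary, bounded heights keep the limit inside the strip, and [intrinsic_segment] bounds the
    distance to it. *)
Lemma tilted_reaper_complete :
  complete_hypersurface (graph reaper_strip tilted_reaper).
Proof.
move=> P SP cauchyP.
have [x Hx] : {x : nat -> 'rV[R]_n & forall i, reaper_strip (x i) /\ graph_point (x i) = P i}.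
  by apply: (@choice _ _ (fun i v => reaper_strip v /\ graph_point v = P i)) => i;
    have [v vOm <-] := SP i; exists v.
have cvgP (l : 'I_(n + 1)) : cvgn (fun i => P i 0 l).
  apply: cvgn_of_cauchy => e e0; have [N HN] := cauchyP e e0.
  exists N => i j Ni Nj; apply: intrinsic_dist_lt_coord; exact: HN.
pose y : 'rV[R]_n := \row_j limn (fun i => P i 0 (lshift 1 j)).
pose U := limn (fun i => P i 0 (rshift n ord0)).
have cx j : x i 0 j @[i --> \oo] --> y 0 j.
  rewrite mxE; apply: cvg_trans (cvgP (lshift 1 j)); apply: near_eq_cvg.
  by apply: nearW => i; rewrite -(Hx i).2 graph_pointl.
have cu : tilted_reaper (x i) @[i --> \oo] --> U.
  apply: cvg_trans (cvgP (rshift n ord0)); apply: near_eq_cvg.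
  by apply: nearW => i; rewrite -(Hx i).2 graph_pointr.
have xw i : - w < x i 0 a < w by rewrite -stripE; exact: (Hx i).1.
have yw : - w <= y 0 a <= w.
  apply/andP; split.
    by apply: (cvgr_to_ge (cx a)); apply: nearW => i; case/andP: (xw i) => /ltW.
  by apply: (cvgr_to_le (cx a)); apply: nearW => i; case/andP: (xw i) => _ /ltW.
(* The graph equation solved for the cosine is continuous up to the boundary, so it passes to the
   limit, and the exponential shows that the cosine is not 0. *)
have cosE : cos (k^-1 * y 0 a) = expR (- (k ^+ 2)^-1 * (U - y 0 b)).
  have c1 : cos (k^-1 * x i 0 a) @[i --> \oo] --> cos (k^-1 * y 0 a).
    apply: continuous_cvg; first exact: continuous_cos.
    by apply: cvgM; [exact: cvg_cst|exact: cx].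
  have c2 : expR (- (k ^+ 2)^-1 * (tilted_reaper (x i) - x i 0 b)) @[i --> \oo] -->
      expR (- (k ^+ 2)^-1 * (U - y 0 b)).
    apply: continuous_cvg; first exact: continuous_expR.
    apply: cvgM; first exact: cvg_cst.
    by apply: cvgB; [exact: cu|exact: cx].
  apply: (cvg_unique _ c1); first exact: Rhausdorff.
  apply: cvg_trans c2; apply: near_eq_cvg; apply: nearW => i.
  have -> : - (k ^+ 2)^-1 * (tilted_reaper (x i) - x i 0 b) = ln (cos (k^-1 * x i 0 a)).
    by rewrite /tilted_reaper addrK /f; field; rewrite gt_eqF.
  by rewrite lnK// posrE cos_gt0.
have cy : cos (k^-1 * y 0 a) != 0 by rewrite cosE gt_eqF ?expR_gt0.
have yw' : - w < y 0 a < w.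
  have kw : k^-1 * w = pi / 2 by rewrite /w mulKf ?gt_eqF.
  case/andP: yw => wy yw; rewrite !lt_neqAle wy yw !andbT; apply/andP; split.
    apply: contra cy => /eqP <-; rewrite mulrN kw.
    by rewrite cosN cos_pihalf.
  by apply: contra cy => /eqP ->; rewrite kw cos_pihalf.
have yOm : reaper_strip y by rewrite stripE.
exists (graph_point y); first by exists y.
(* A half width strictly between that of the limit point and [w]: eventually the whole sequence lies
   in one substrip, with a single Lipschitz constant [K]. *)
pose r := (`|y 0 a| + w) / 2.
have ya_w : `|y 0 a| < w by rewrite ltr_norml.
have yr : `|y 0 a| < r by rewrite /r; lra.
have rw : r < w by rewrite /r; lra.
pose K := 2 + k / cos (k^-1 * r).
have cM : ((K * \sum_j `|y 0 j - x i 0 j|)%:E) @[i --> \oo] --> (0 : \bar R).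
  apply: cvg_EFin; first exact: nearW.
  rewrite -[X in _ --> X](mulr0 K); apply: cvgM; first exact: cvg_cst.
  have cS : (\sum_(j < n) `|y 0 j - x i 0 j|) @[i --> \oo] --> \sum_(j < n) (0 : R).
    apply: cvg_big => [|j _]; first exact: add_continuous.
    rewrite -[X in _ --> X](@normr0 R R); apply: cvg_norm.
    by rewrite -[X in _ --> X](subrr (y 0 j)); apply: cvgB; [exact: cvg_cst|exact: cx].
  have s0 : \sum_(j < n) (0 : R) = 0 by rewrite big1.
  by move: cS; rewrite s0.
apply: squeeze_cvge cM; last exact: cvg_cst.
have xr : \forall i \near \oo, `|x i 0 a| < r.
  by apply: (cvgr_lt _ (cvg_norm (cx a))).
near=> i; rewrite intrinsic_dist_ge0 /= -(Hx i).2.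
by apply: intrinsic_segment => //; apply/ltW => //; near: i.
Unshelve. all: by end_near. Qed.

End GrimReaper.

Theorem theorem1p2 (R : realType) (sigma : R) (hsigma : 0 <= sigma <= 1) :
  (forall n k : nat, (2 <= n)%N -> (1 <= k <= n)%N ->
     exists (Om : set 'rV[R]_n) (u : 'rV[R]_n -> R),
       [/\ strip_region Om,
           complete_convex_solution sigma Om u
         & ~ k_rotationally_symmetric k Om u])
  /\
  (forall n k : nat, (3 <= n)%N -> (1 <= k <= n)%N ->
     exists u : 'rV[R]_n -> R,
       entire_convex_solution sigma u /\
       ~ k_rotationally_symmetric k [set: 'rV[R]_n] u).
Proof.
have /andP[s0 _] := hsigma.
have c0 : 0 < sigma + 1 by rewrite ltr_wpDl.
split=> [n k n2 _|n k n3 _].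
(* One coordinate carries the grim reaper, the other the tilt. *)
- pose a := Ordinal (ltnW n2); pose b := Ordinal n2.
  have ab : a != b by [].
  have q0 : 0 < Num.sqrt (sigma + 1) by rewrite sqrtr_gt0.
  exists (reaper_strip a (Num.sqrt (sigma + 1))),
    (tilted_reaper a b (Num.sqrt (sigma + 1))); split.
  + exists (delta_mx 0 a), (- (Num.sqrt (sigma + 1) * (pi / 2))),
      (Num.sqrt (sigma + 1) * (pi / 2)); split=> //; first exact: delta_row_neq0.
    by rewrite gtrN// mulr_gt0// divr_gt0// pi_gt0.
  + split; last exact: tilted_reaper_complete.
    by apply: tilted_reaper_solution => //; rewrite sqr_sqrtr// ltW.
  + exact: tilted_reaper_not_rotational.
(* Two coordinates carry the bowl and the third the tilt; here n >= 3 enters. *)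
- pose a := Ordinal (ltnW (ltnW n3)); pose b := Ordinal (ltnW n3); pose d := Ordinal n3.
  have [ab ad bd] : [/\ a != b, a != d & b != d] by [].
  have [G [p [dp [dG dpE cdp p01 ode]]]] := bowl_profile R.
  exists (tilted_bowl a b d (sigma + 1) G); split.
    exact: (tilted_bowl_solution ab ad bd c0 dG dpE cdp p01 ode).
  exact: tilted_bowl_not_rotational.
Qed.
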